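(* There exist absolute constants $\epsilon_0,\delta_0\in(0,1)$ and $C>0$ such that the following holds. Let $n\ge 1$, let $\mathsf{X}\subseteq\mathsf{P}^n$ contain a nonzero element, and let $\mathsf{O}$ be a stabilizer covering of $\mathsf{X}$. Assume the noise is GTM with noise map $\Lambda$, is $\tfrac12$-weak, that the SPAM parameters $A_{\mathsf{S},h}$ are $\tfrac12$-stable for all $\mathsf{S}\in\mathsf{O}$, $h\in\mathsf{S}$, and that $\Delta_{\mathsf{X}}>0$. Let $0<\epsilon\le\epsilon_0$ and $0<\delta\le\delta_0$, and put $K=\lceil C\log(1/\Delta_{\mathsf{X}})\rceil$ and $$t=\Big\lceil\frac{2}{\epsilon^2}\log\Big(\frac{2|\mathsf{X}|K}{\delta}\Big)\Big\rceil .$$ Then with probability at least $1-\delta$ the procedure $\mathbf{Ratio}(\mathsf{O},\mathsf{X},t)$ terminates, the set $\kappa$ of sequence lengths $m$ that it uses satisfies $|\kappa|\le K$ (so $|\kappa|=O(\log\frac{1}{\Delta_{\mathsf X}})$) and $\max\kappa\le C/\Delta_{\mathsf{X}}$, and its output $\hat{\boldsymbol r}_{\mathsf{X}}$ satisfies $$|\hat r_x-r_x|\le C\,\epsilon\, r_x\qquad\text{for all }x\in\mathsf{X}.$$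
   Context: Pauli labels. Let $d=2^n$. $\mathsf{P}^n$ denotes the $n$-qubit Pauli group modulo phases, identified with $\mathbb{Z}_2^{2n}$: $a=(a_x,a_z)$ labels the Hermitian matrix $P_a=i^{a_x\cdot a_z}X[a_x]Z[a_z]$, where $A[v]=\bigotimes_i A^{v_i}$ and $X,Z$ are the single-qubit Pauli matrices. Let $\langle a,b\rangle=a_x\cdot b_z+a_z\cdot b_x \bmod 2$. A stabilizer group is a subgroup $\mathsf{S}\subseteq\mathsf{P}^n$ with $\langle a,b\rangle=0$ for all $a,b\in\mathsf{S}$. A stabilizer covering of a set $\mathsf{X}\subseteq\mathsf{P}^n$ is a set $\mathsf{O}$ of stabilizer groups whose union contains $\mathsf{X}$. For a group $\mathsf{G}\subseteq\mathsf{P}^n$, $\mathsf{C_G}=\{a:\langle a,g\rangle=0\ \forall g\in\mathsf{G}\}$ and $\mathsf{A_G}=\mathsf{P}^n/\mathsf{C_G}$; for $g\in\mathsf G$ and $z\in\mathsf{A_G}$ the value $\langle g,z\rangle$ is well defined. Write $|a)=d^{-1/2}P_a$ as a vector in the Hilbert–Schmidt space with $(A|B)=\mathrm{Tr}(A^\dagger B)$; channels act as superoperators. $\mathcal{P}_a(M)=P_aMP_a^\dagger$. Noise model (GTM: gate-independent, time-stationary, Markovian). There is a fixed completely positive trace-preserving map $\Lambda$ such that the noisy implementation of every Pauli gate $\mathcal{P}_a$ is $\mathcal{P}_a\Lambda$; for each stabilizer group $\mathsf{S}$ there is a fixed density operator $\tilde\rho_{\mathsf{S},0}$ (noisy preparation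 of the stabilizer state of $\mathsf S$) and a fixed POVM $\{\tilde E_{\mathsf{S},b}:b\in\mathsf{A_S}\}$ (noisy syndrome measurement of $\mathsf{S}$). Pauli eigenvalues: $f_a=(a|\Lambda|a)$; $r_a=1-f_a$. The noise is $\tfrac12$-weak if $f_a\in[\tfrac12,1]$ for all $a\in\mathsf{P}^n$. SPAM parameters: $A_{\mathsf{S},h}=\sum_{b\in\mathsf{A_S}}(-1)^{\langle h,b\rangle}(\tilde E_{\mathsf{S},b}|h)(h|\Lambda|\tilde\rho_{\mathsf{S},0})$ for $h\in\mathsf{S}$; such a parameter is $\tfrac12$-stable if $A_{\mathsf{S},h}\ge\tfrac12$. Spectral gap: $\Delta_{\mathsf{X}}=1-\max_{x\in\mathsf{X}\setminus\{0\}}|f_x|$. Procedure $\mathbf{RunCB}(\mathsf{S},m)$: prepare $\tilde\rho_{\mathsf{S},0}$; for $i=0,\dots,m$ apply a noisy Pauli gate $P_{a_i}$ with $a_i\in\mathsf{P}^n$ independent and uniform; perform the noisy syndrome measurement of $\mathsf{S}$, getting $b\in\mathsf{A_S}$; return $z=b+\sum_i a_i\in\mathsf{A_S}$. All calls are independent. Procedure $\mathbf{V}(\mathsf{X}',\mathsf{S},t,m)$ (for $\mathsf{X}'\subseteq\mathsf{S}$): call $\mathbf{RunCB}(\mathsf{S},m)$ $t$ times, getting $z_1,\dots,z_t$; return the vector with entries $\frac1t\sum_{k=1}^t(-1)^{\langle x,z_k\rangle}$, $x\in\mathsf{X}'$. Procedure $\mathbf{Ratio}(\mathsf{O},\mathsf{X},t)$: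 set $\hat r_0=0$ if $0\in\mathsf X$; all other $\hat r_x$ ($x\in\mathsf{X}$) start undefined; set $\mathsf{A}=\emptyset$. For each $\mathsf{S}\in\mathsf{O}$: let $\mathsf{X}'=(\mathsf{X}\cap\mathsf{S})\setminus(\mathsf{A}\cup\{0\})$; replace $\mathsf{A}$ by $\mathsf{A}\cup\mathsf{S}$; if $\mathsf X'\neq\emptyset$, compute $\hat V=\mathbf{V}(\mathsf{X}',\mathsf{S},t,0)$; set $m=1$; while some $\hat r_x$, $x\in\mathsf{X}'$, is undefined: compute $\hat W=\mathbf{V}(\mathsf{X}',\mathsf{S},t,m)$; for each $x\in\mathsf{X}'$ with $\hat r_x$ undefined, put $v=\hat V(x)$, $w=\hat W(x)$; if $w\le v/3$ and $v,w>0$ set $\hat r_x=1-(w/v)^{1/m}$, else if $w\le 0$ or $v\le 0$ set $\hat r_x=1$; then replace $m$ by $2m$. Return $(\hat r_x)_{x\in\mathsf{X}}$. The set $\kappa$ is the set of all sequence lengths $m$ (including $0$) used in calls to $\mathbf V$. *)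

(* Defs.v *)
From HB Require Import structures.
From mathcomp Require Import all_boot all_order all_algebra all_fingroup finmap.
From mathcomp Require Import sesquilinear spectral complex.
From mathcomp Require mxtens.
From mathcomp Require Import all_classical all_reals all_analysis.

Set Implicit Arguments.
Unset Strict Implicit.
Unset Printing Implicit Defensive.

Import Order.TTheory GRing.Theory Num.Theory.
Local Open Scope ring_scope.
Local Open Scope sesquilinear_scope.

Local Notation "A *t B" := (mxtens.tensmx A B)
  (at level 40, left associativity).

(* A label a is the pair (a_x, a_z).  The type is both an additive group and
   a finGroupType; the two group laws are convertible, so {group pauli n} is
   the type of subgroups of (Z_2)^2n and G / H is the usual quotient. *)
Notation pauli n := ('rV['F_2]_n * 'rV['F_2]_n)%type.

Section Labels.
Variable n : nat.
Implicit Types a b : pauli n.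

Definition symp a b : 'F_2 :=
  (\sum_i a.1 0 i * b.2 0 i) + (\sum_i a.2 0 i * b.1 0 i).

Definition centr (G : {set pauli n}) : {set pauli n} :=
  [set a | [forall g in G, symp a g == 0]]%SET.

Lemma centr_group_set G : group_set (centr G).
Proof.
apply/group_setP; split=> [|a b].
  rewrite inE; apply/forall_inP=> g _; rewrite /symp.
  by rewrite !big1 ?addr0 // => i _; rewrite mxE mul0r.
rewrite !inE => /forall_inP Ha /forall_inP Hb; apply/forall_inP=> g Gg.
have -> : symp (a * b)%g g = symp a g + symp b g.
  rewrite /symp addrACA -!big_split /=.
  by apply: eq_bigr => i _; rewrite !mxE !mulrDl.
by rewrite (eqP (Ha _ Gg)) (eqP (Hb _ Gg)) addr0.
Qed.
Canonical centr_group G := Group (centr_group_set G).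

(* The quotient group A_G = P^n / C_G.  P^n is abelian, so every coset is
   bilateral and coset_of (centr G) is the whole quotient. *)
Definition syndrome (G : {group pauli n}) := coset_of (centr G).

(* <g, z> for z in A_G; it does not depend on the representative of z as long
   as g belongs to G. *)
Definition sympq (G : {group pauli n}) a (z : syndrome G) : 'F_2 :=
  symp a (repr z).

Definition stabilizer (S : {group pauli n}) : Prop :=
  forall a b, a \in S -> b \in S -> symp a b = 0.

Definition stabilizer_covering (O : {set {group pauli n}}) (X : {set pauli n}) :
    Prop :=
  (forall S, S \in O -> stabilizer S) /\
  (forall x, x \in X -> exists2 S, S \in O & x \in S).

End Labels.

Section Quantum.
Variable R : realType.
Local Notation C := R[i].

(* A ord0 (x) A 1 (x) ... (x) A (n-1), by iterated Kronecker products *)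
Fixpoint tens n : ('I_n -> 'M[C]_2) -> 'M[C]_(2 ^ n) :=
  match n with
  | 0 => fun=> 1%:M
  | n'.+1 => fun A =>
      castmx (esym (expnS 2 n'), esym (expnS 2 n'))
        (A ord0 *t tens (fun i => A (lift ord0 i)))
  end.

Definition sigmaX : 'M[C]_2 := \matrix_(i, j) (i != j)%:R.
Definition sigmaZ : 'M[C]_2 := \matrix_(i, j) ((-1) ^+ i *+ (i == j)).

(* The exponent a_x . a_z of the phase is the dot product in the natural
   numbers (it matters modulo 4): it counts the tensor factors equal to
   i X Z = Y. *)
Definition pauli_mx n (a : pauli n) : 'M[C]_(2 ^ n) :=
  'i%C ^+ (\sum_i a.1 0%R i * a.2 0%R i)%N *:
    (tens (fun i => sigmaX ^+ a.1 0 i) *m tens (fun i => sigmaZ ^+ a.2 0 i)).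

Definition pauli_ket n (a : pauli n) : 'M[C]_(2 ^ n) :=
  (sqrtC (2 ^ n)%N%:R)^-1 *: pauli_mx a.

Definition hs d (A B : 'M[C]_d) : C := \tr (A ^t* *m B).

Definition pauli_channel n (a : pauli n) (M : 'M[C]_(2 ^ n)) : 'M[C]_(2 ^ n) :=
  pauli_mx a *m M *m (pauli_mx a) ^t*.

(* In the order of R[i], 0 <= c means that c is real and nonnegative. *)
Definition psd d (A : 'M[C]_d) : Prop :=
  A ^t* = A /\ forall v : 'cV[C]_d, 0 <= (v ^t* *m A *m v) 0 0.

(* The superoperator id_k (x) L on k x k block matrices *)
Definition ampliation k d (L : 'M[C]_d -> 'M[C]_d) (M : 'M[C]_(k * d)) :
    'M[C]_(k * d) :=
  \sum_(i < k) \sum_(j < k) delta_mx i j *t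
    L (\matrix_(p, q) M (mxtens.mxtens_index (i, p))
                        (mxtens.mxtens_index (j, q))).

Definition completely_positive d (L : 'M[C]_d -> 'M[C]_d) : Prop :=
  forall k (M : 'M[C]_(k * d)), psd M -> psd (ampliation L M).

Definition trace_preserving d (L : 'M[C]_d -> 'M[C]_d) : Prop :=
  forall M, \tr (L M) = \tr M.

Definition density_operator d (rho : 'M[C]_d) : Prop := psd rho /\ \tr rho = 1.

Definition is_povm d (I : finType) (E : I -> 'M[C]_d) : Prop :=
  (forall b, psd (E b)) /\ \sum_b E b = 1%:M.

(* prep and povm are only constrained on stabilizer groups; their values on
   other subgroups are never used. *)
Record gtm_noise n := GTMNoise {
  noise : {linear 'M[C]_(2 ^ n) -> 'M[C]_(2 ^ n)};
  prep : {group pauli n} -> 'M[C]_(2 ^ n);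
  povm : forall S : {group pauli n}, syndrome S -> 'M[C]_(2 ^ n);
  noise_cp : completely_positive noise;
  noise_tp : trace_preserving noise;
  prep_density : forall S, stabilizer S -> density_operator (prep S);
  povm_povm : forall S, stabilizer S -> is_povm (povm (S := S))
}.

Section Noise.
Variables (n : nat) (N : gtm_noise n).

(* The quantities below are real because noise preserves Hermiticity and the
   P_a are Hermitian; Re only performs the change of type. *)
Definition eigval (a : pauli n) : R :=
  complex.Re (hs (pauli_ket a) (noise N (pauli_ket a))).

Definition infid (a : pauli n) : R := 1 - eigval a.

Definition half_weak : Prop := forall a, 2^-1 <= eigval a <= 1.

Definition spam (S : {group pauli n}) (h : pauli n) : R :=
  complex.Re (\sum_(b : syndrome S) (-1) ^+ sympq h b *
    (hs (povm N b) (pauli_ket h) *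
     hs (pauli_ket h) (noise N (prep N S)))).

(* The values are nonnegative, so the default 0 of the maximum is harmless
   when X contains a nonzero label. *)
Definition gap (X : {set pauli n}) : R :=
  1 - \big[Num.max/0]_(x in (X :\ (0 : pauli n))%SET) `|eigval x|.

(* State after the noisy gates P_(a_0), ..., P_(a_m), applied in this order. *)
Definition circuit (S : {group pauli n}) (a : seq (pauli n)) : 'M[C]_(2 ^ n) :=
  foldl (fun M c => pauli_channel c (noise N M)) (prep N S) a.

(* Law of the output z = b + sum_i a_i of RunCB(S, m): the m+1 gates are
   independent and uniform, and b follows the Born rule given the gates. *)
Definition runcb_pmf (S : {group pauli n}) (m : nat) (z : syndrome S) : R :=
  \sum_(a : m.+1.-tuple (pauli n))
    (#|{: pauli n}|%:R ^- m.+1) *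
    \sum_(b : syndrome S | (b * coset (centr S) (\sum_(c <- a) c))%g == z)
      complex.Re (hs (povm N b) (circuit S a)).

(* Outcomes of all the calls to RunCB: Z S m k is the result of the k-th call
   to RunCB(S, m).  The calls are mutually independent, and the k-th call with
   parameters (S, m) has the law runcb_pmf S m. *)
Definition runcb_samples d (T : measurableType d) (P : probability T R)
    (Z : forall S : {group pauli n}, nat -> nat -> T -> syndrome S) : Prop :=
  (forall S m k b, stabilizer S -> measurable (Z S m k @^-1` [set b]%classic)) /\
  (forall (I : seq ({group pauli n} * nat * nat))
          (z : forall S : {group pauli n}, nat -> nat -> syndrome S),
    uniq I -> (forall i, i \in I -> stabilizer i.1.1) ->
    P (\bigcap_(i in [set` I])
         (Z i.1.1 i.1.2 i.2 @^-1` [set z i.1.1 i.1.2 i.2]))%classic =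
    (\prod_(i <- I) runcb_pmf i.1.2 (z i.1.1 i.1.2 i.2))%:E).

End Noise.

(* The procedures are deterministic functions of the table z of outcomes of
   the calls to RunCB.  A run of Ratio calls V at most once for each pair
   (S, m), so V with parameters (S, m) reads the entries z S m k, k < t. *)
Section Procedure.
Variables (n : nat).
Variable z : forall S : {group pauli n}, nat -> nat -> syndrome S.
Variables (X : {set pauli n}) (t : nat).

Definition estV (S : {group pauli n}) (m : nat) (x : pauli n) : R :=
  t%:R^-1 * \sum_(k < t) (-1) ^+ sympq x (z S m k).

(* None stands for an undefined entry *)
Definition estimate := {ffun pauli n -> option R}.

Definition all_defined (X' : {set pauli n}) (r : estimate) : bool :=
  [forall x in X', r x != None].

Definition update (S : {group pauli n}) (X' : {set pauli n}) (m : nat)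
    (r : estimate) : estimate :=
  [ffun x =>
    if (x \in X') && (r x == None) then
      let v := estV S 0 x in
      let w := estV S m x in
      if [&& w <= v / 3, 0 < v & 0 < w] then Some (1 - (w / v) `^ m%:R^-1)
      else if (w <= 0) || (v <= 0) then Some 1 else None
    else r x].

(* while_run S X' m r r' ks: the while loop entered with length m and estimate
   r terminates with estimate r', using the lengths ks. *)
Inductive while_run (S : {group pauli n}) (X' : {set pauli n}) :
    nat -> estimate -> estimate -> {fset nat} -> Prop :=
| While_stop m r :
    all_defined X' r -> while_run S X' m r r fset0
| While_step m r r' ks :
    ~~ all_defined X' r ->
    while_run S X' (2 * m)%N (update S X' m r) r' ks ->
    while_run S X' m r r' (m |` ks)%fset.

Definition fresh (S : {group pauli n}) (A : {set pauli n}) : {set pauli n} :=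
  ((X :&: S) :\: (A :|: [set (0 : pauli n)]))%SET.

Inductive for_run : seq {group pauli n} -> {set pauli n} ->
    estimate -> estimate -> {fset nat} -> Prop :=
| For_done A r :
    for_run [::] A r r fset0
| For_skip S os A r r' ks :
    fresh S A = finset.set0 ->
    for_run os (A :|: S)%SET r r' ks ->
    for_run (S :: os) A r r' ks
| For_visit S os A r r1 r' ks1 ks :
    fresh S A <> finset.set0 ->
    while_run S (fresh S A) 1%N r r1 ks1 ->
    for_run os (A :|: S)%SET r1 r' ks ->
    for_run (S :: os) A r r' (0%N |` (ks1 `|` ks))%fset.

(* ratio_run os r ks: Ratio terminates with output r and set of sequence
   lengths ks, when the groups are processed in the order of the list os.
   Nontermination of a while loop means that there is no such r and ks. *)
Definition ratio_run (os : seq {group pauli n}) (r : estimate)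
    (ks : {fset nat}) : Prop :=
  for_run os finset.set0
    [ffun x : pauli n => if (x == 0) && (x \in X) then Some 0 else None] r ks.

End Procedure.
End Quantum.

(* Main.v *)
Require Import Defs.
From HB Require Import structures.
From mathcomp Require Import all_boot all_order all_algebra all_fingroup finmap.
From mathcomp Require Import sesquilinear spectral complex.
From mathcomp Require mxtens.
From mathcomp Require Import all_classical all_reals all_analysis.
From mathcomp Require Import ring lra.

(* Twirling by uniformly random Paulis, weighted with the character
   a |-> (-1)^<x,a>, projects every operator on the line spanned by P_x.  Hence
   a single run of RunCB(S, m) satisfies E (-1)^<x,z> = A_{S,x} f_x^m for x in S,
   and by Hoeffding's inequality and a union bound all the estimates at the
   lengths 0, 1, 2, 4, ..., 2^J, with 2^J between 2/gap and 4/gap, are within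
   3 eps of these values with probability at least 1 - delta.  On that event the
   estimate of x is fixed at the first doubling m for which w <= v/3: then
   f_x^m <= 1/2, so that 1/m <= 2 r_x by Bernoulli's inequality, while
   f_x^(m/2) >= 3/10 keeps the relative error of w/v, hence m times that of its
   m-th root, of order eps. *)

Set Implicit Arguments.
Unset Strict Implicit.
Unset Printing Implicit Defensive.

Import Order.TTheory GRing.Theory Num.Theory.
Local Open Scope ring_scope.

(** * Pauli matrices *)

Section PauliAlgebra.
Local Open Scope sesquilinear_scope.
Variable R : realType.
Local Notation C := R[i].

(** Which lengths a run uses depends on its own random outcomes, so deviations are controlled
    beforehand at every doubling up to 2^J, and a run is then analysed deterministically. [Ratio]
    estimates x only in the first group of the list that contains it; hence the union bound ranges
    over pairs (x, m), at most |X| K of them whatever the number of groups. The numerical thresholds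
    interlock: a failed test leaves f_x^m large enough that its square, the value at the next
    doubling, is still at least 9/100, well above the noise. There v and w are positive, so the
    fallback estimate 1 never occurs on the good event; and f_x^m <= 1/4, which holds at m = 2^J,
    forces the test to succeed. Measurability of the good event needs its own argument, since that
    event is defined by the existence of a run: its bound on the lengths makes it depend on finitely
    many outcomes. *)

Lemma F2_cases (u : 'F_2) : u = 0 \/ u = 1.
Proof.
case: u => [[|[|//]] ?]; [left|right]; exact/val_inj.
Qed.

Lemma nat_of_F2_0 : (0 : 'F_2) = 0%N :> nat. Proof. by []. Qed.

Lemma nat_of_F2_1 : (1 : 'F_2) = 1%N :> nat. Proof. by []. Qed.

Definition natF2 := (nat_of_F2_0, nat_of_F2_1).

Lemma addF2_11 : 1 + 1 = 0 :> 'F_2. Proof. exact/val_inj. Qed.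

Lemma signF2D (K : pzRingType) (u v : 'F_2) :
  (-1) ^+ (u + v)%R = (-1) ^+ u * (-1) ^+ v :> K.
Proof.
case: (F2_cases u) => ->; first by rewrite add0r natF2 expr0 mul1r.
case: (F2_cases v) => ->; first by rewrite addr0 natF2 expr0 mulr1.
by rewrite addF2_11 natF2 expr0 expr1 mulrNN mulr1.
Qed.

(** * Adjoints and Kronecker products *)

Lemma adjmxM (m n p : nat) (A : 'M[C]_(m, n)) (B : 'M[C]_(n, p)) :
  (A *m B) ^t* = B ^t* *m A ^t*.
Proof. by rewrite trmx_mul map_mxM. Qed.

Lemma adjmxZ (m n : nat) (c : C) (A : 'M[C]_(m, n)) :
  (c *: A) ^t* = c^* *: A ^t*.
Proof. by apply/matrixP=> i j; rewrite !mxE rmorphM. Qed.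

(** The recursive step of [tens], with the cast of dimensions hidden so that the product rules can
    be used without it. *)
Definition kron n (A : 'M[C]_2) (B : 'M[C]_(2 ^ n)) : 'M[C]_(2 ^ n.+1) :=
  castmx (esym (expnS 2 n), esym (expnS 2 n)) (mxtens.tensmx A B).

Lemma kronM n A (B : 'M[C]_(2 ^ n)) A' B' :
  kron A B *m kron A' B' = kron (A *m A') (B *m B').
Proof.
rewrite /kron -mxtens.tensmx_mul; move: (mxtens.tensmx A B) (mxtens.tensmx A' B').
by move: (esym (expnS 2 n)) => e; case: _ / e.
Qed.

Lemma kron_adj n A (B : 'M[C]_(2 ^ n)) : (kron A B) ^t* = kron (A ^t*) (B ^t*).
Proof.
rewrite /kron -mxtens.map_mxT -mxtens.trmx_tens; move: (mxtens.tensmx A B).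
by move: (esym (expnS 2 n)) => e; case: _ / e.
Qed.

Lemma kron1 n : kron 1%:M 1%:M = 1%:M :> 'M[C]_(2 ^ n.+1).
Proof.
have -> : kron 1%:M 1%:M = castmx (esym (expnS 2 n), esym (expnS 2 n)) 1%:M :> 'M[C]_(2 ^ n.+1).
  congr castmx; apply/matrixP=> k l.
  case: (mxtens.mxtens_indexP k) => i p; case: (mxtens.mxtens_indexP l) => j q.
  rewrite mxtens.tensmxE !mxE -natrM mulnb.
  by rewrite (inj_eq (can_inj (@mxtens.mxtens_indexK _ _))).
by move: (esym _) => e; case: _ / e.
Qed.

Lemma kronZl n c A (B : 'M[C]_(2 ^ n)) : kron (c *: A) B = c *: kron A B.
Proof.
have -> : kron (c *: A) B = castmx (esym (expnS 2 n), esym (expnS 2 n))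
   (c *: mxtens.tensmx A B).
  by congr castmx; apply/matrixP=> i j; rewrite !mxE mulrA.
by rewrite /kron; move: (esym _) => e; apply/matrixP=> i j; rewrite !(castmxE, mxE).
Qed.

Lemma kronZr n c A (B : 'M[C]_(2 ^ n)) : kron A (c *: B) = c *: kron A B.
Proof.
rewrite -kronZl; congr castmx.
by apply/matrixP=> i j; rewrite !mxE mulrCA mulrA.
Qed.

Lemma kronDl n A A' (B : 'M[C]_(2 ^ n)) :
  kron (A + A') B = kron A B + kron A' B.
Proof. by apply/matrixP=> i j; rewrite !(castmxE, mxE) mulrDl. Qed.

Lemma kronDr n A (B B' : 'M[C]_(2 ^ n)) :
  kron A (B + B') = kron A B + kron A B'.
Proof. by apply/matrixP=> i j; rewrite !(castmxE, mxE) mulrDr. Qed.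

(** A matrix is the sum over i, j of the Kronecker product of the matrix unit E_ij with its block
    (i, j). *)
Lemma kron_ind n (Q : 'M[C]_(2 ^ n.+1) -> Prop) :
  Q 0 -> (forall M N, Q M -> Q N -> Q (M + N)) ->
  (forall A B, Q (kron A B)) -> forall M, Q M.
Proof.
move=> Q0 QD QK M.
pose M' := castmx (expnS 2 n, expnS 2 n) M.
pose blk (i j : 'I_2) : 'M[C]_(2 ^ n) := \matrix_(p, q)
  M' (mxtens.mxtens_index (i, p)) (mxtens.mxtens_index (j, q)).
have -> : M = \sum_(i < 2) \sum_(j < 2) kron (delta_mx i j) (blk i j).
  apply/matrixP=> k l.
  have E A (B : 'M[C]_(2 ^ n)) : kron A B k l =
     mxtens.tensmx A B (cast_ord (expnS 2 n) k) (cast_ord (expnS 2 n) l).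
    by rewrite castmxE /= !esymK.
  have -> : M k l = M' (cast_ord (expnS 2 n) k) (cast_ord (expnS 2 n) l).
    by rewrite castmxE !cast_ordK.
  rewrite summxE; under eq_bigr do rewrite summxE; under eq_bigr do
    under eq_bigr do rewrite E.
  move: (cast_ord _ k) (cast_ord _ l) => {E} {}k {}l.
  case: (mxtens.mxtens_indexP k) => i p; case: (mxtens.mxtens_indexP l) => j q.
  rewrite (bigD1 i) //= (bigD1 j) //= !mxtens.tensmxE !mxE !eqxx mul1r.
  rewrite !big1 ?addr0 // => [i' ii'|j' jj'].
    rewrite big1 // => j' _; rewrite mxtens.tensmxE !mxE.
    by rewrite eq_sym (negbTE ii') mul0r.
  by rewrite mxtens.tensmxE !mxE [j == _]eq_sym (negbTE jj') andbF mul0r.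
by do 2![elim/big_ind: _ => // ? _].
Qed.

(** The one-qubit Paulis: the identity, X, Z and, for u = v = 1, i X Z = Y. *)
Definition sigma (u v : 'F_2) : 'M[C]_2 :=
  'i%C ^+ (u * v)%N *: (sigmaX R ^+ u *m sigmaZ R ^+ v).

Definition ptail n (a : pauli n.+1) : pauli n :=
  (\row_i a.1 0 (lift ord0 i), \row_i a.2 0 (lift ord0 i)).

(** The phase exponent is a sum over qubits in the natural numbers, so it splits along the first
    tensor factor. This reduces facts on Pauli matrices to one qubit by induction. *)
Lemma pauli_mxS n (a : pauli n.+1) :
  pauli_mx R a = kron (sigma (a.1 0 0) (a.2 0 0)) (pauli_mx R (ptail a)).
Proof.
rewrite /pauli_mx big_ord_recl exprD /= -/(kron _ _) -/(kron _ _) kronM.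
rewrite /sigma kronZl kronZr scalerA.
congr (_ *: kron _ _); first congr (_ * _ ^+ _).
  by apply: eq_bigr => i _; rewrite !mxE.
by congr (_ *m _); congr tens; apply/funext=> i; rewrite mxE.
Qed.

Lemma sympS n (a b : pauli n.+1) :
  symp a b = a.1 0 0 * b.2 0 0 + a.2 0 0 * b.1 0 0 + symp (ptail a) (ptail b).
Proof.
rewrite /symp !big_ord_recl addrACA; congr (_ + (_ + _));
by apply: eq_bigr => i _; rewrite !mxE.
Qed.

(** * Algebra of the one-qubit Paulis *)

Lemma sigmaX2 : sigmaX R *m sigmaX R = 1%:M.
Proof.
apply/matrixP=> i j; rewrite !mxE !big_ord_recl big_ord0 !mxE.
by case: i => [[|[|//]] ?]; case: j => [[|[|//]] ?]; rewrite /= -?val_eqE /=;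
   rewrite ?(mulr0, mul0r, mulr1, addr0, add0r).
Qed.

Lemma sigmaZ2 : sigmaZ R *m sigmaZ R = 1%:M.
Proof.
apply/matrixP=> i j; rewrite !mxE !big_ord_recl big_ord0 !mxE.
by case: i => [[|[|//]] ?]; case: j => [[|[|//]] ?]; rewrite /= -?val_eqE /=
  ?mulr1n ?mulr0n ?expr0 ?expr1; ring.
Qed.

Lemma sigmaZX : sigmaZ R *m sigmaX R = - (sigmaX R *m sigmaZ R).
Proof.
apply/matrixP=> i j; rewrite !mxE !big_ord_recl !big_ord0 !mxE.
by case: i => [[|[|//]] ?]; case: j => [[|[|//]] ?]; rewrite /= -?val_eqE /=
  ?mulr1n ?mulr0n ?expr0 ?expr1; ring.
Qed.

Lemma sigmaX_adj : (sigmaX R) ^t* = sigmaX R.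
Proof. by apply/matrixP=> i j; rewrite !mxE conjC_nat eq_sym. Qed.

Lemma sigmaZ_adj : (sigmaZ R) ^t* = sigmaZ R.
Proof.
apply/matrixP=> i j; rewrite !mxE rmorphMn rmorphXn rmorphN rmorph1 eq_sym.
by case: eqP => [->|]; rewrite ?mulr0n.
Qed.

Lemma sigma00 : sigma 0 0 = 1%:M.
Proof. by rewrite /sigma !natF2 muln0 !expr0 scale1r mulmx1. Qed.

Lemma sigma10 : sigma 1 0 = sigmaX R.
Proof. by rewrite /sigma !natF2 muln0 !expr0 expr1 scale1r mulmx1. Qed.

Lemma sigma01 : sigma 0 1 = sigmaZ R.
Proof. by rewrite /sigma !natF2 mul0n !expr0 expr1 scale1r mul1mx. Qed.

Lemma sigma11 : sigma 1 1 = 'i%C *: (sigmaX R *m sigmaZ R).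
Proof. by rewrite /sigma !natF2 mul1n !expr1. Qed.

Lemma sigma_adj u v : (sigma u v) ^t* = sigma u v.
Proof.
case: (F2_cases u) => ->; case: (F2_cases v) => ->;
  rewrite ?(sigma00, sigma10, sigma01, sigma11).
- by rewrite trmx1 map_mx1.
- exact: sigmaZ_adj.
- exact: sigmaX_adj.
have conji : ('i%C : C)^* = - 'i%C by rewrite /Num.conj /=; congr Complex; rewrite ?oppr0.
by rewrite adjmxZ adjmxM sigmaX_adj sigmaZ_adj sigmaZX conji scaleNr scalerN opprK.
Qed.

Lemma sigma_sq u v : sigma u v *m sigma u v = 1%:M.
Proof.
case: (F2_cases u) => ->; case: (F2_cases v) => ->;
  rewrite ?(sigma00, sigma10, sigma01, sigma11).
- by rewrite mulmx1.
- exact: sigmaZ2.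
- exact: sigmaX2.
rewrite -scalemxAl -scalemxAr scalerA -mulmxA [sigmaZ R *m _]mulmxA sigmaZX mulNmx mulmxN.
rewrite mulmxA -expr2 sqr_i scaleN1r opprK.
by rewrite mulmxA sigmaX2 mul1mx sigmaZ2.
Qed.

Lemma sigma_comm u v u' v' : sigma u v *m sigma u' v' =
  (-1) ^+ (u * v' + v * u')%R *: (sigma u' v' *m sigma u v).
Proof.
have ZX (a b : 'F_2) : sigmaZ R ^+ b *m sigmaX R ^+ a =
    (-1) ^+ (a * b)%R *: (sigmaX R ^+ a *m sigmaZ R ^+ b).
  case: (F2_cases a) => ->; first by rewrite mul0r natF2 !expr0 mul1mx mulmx1 scale1r.
  case: (F2_cases b) => ->; first by rewrite mulr0 natF2 !expr0 mul1mx mulmx1 scale1r.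
  by rewrite mulr1 natF2 !expr1 scaleN1r sigmaZX.
(* Normal form with the X powers on the left: moving Z^b past X^a' costs the sign (-1)^(a' b). Both
   products then differ by signs only. *)
have sM (a b a' b' : 'F_2) : sigma a b *m sigma a' b' =
    ('i%C ^+ (a * b)%N * 'i%C ^+ (a' * b')%N * (-1) ^+ (a' * b)%R) *:
    ((sigmaX R ^+ a *m sigmaX R ^+ a') *m (sigmaZ R ^+ b *m sigmaZ R ^+ b')).
  rewrite /sigma -scalemxAl -scalemxAr scalerA -[RHS]scalerA; congr (_ *: _).
  by rewrite -[LHS]mulmxA [sigmaZ R ^+ b *m (_ *m _)]mulmxA ZX -scalemxAl -scalemxAr !mulmxA.
rewrite !sM scalerA signF2D.
have -> : sigmaX R ^+ u *m sigmaX R ^+ u' = sigmaX R ^+ u' *m sigmaX R ^+ u.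
  by rewrite -[LHS]exprD addnC exprD.
have -> : sigmaZ R ^+ v *m sigmaZ R ^+ v' = sigmaZ R ^+ v' *m sigmaZ R ^+ v.
  by rewrite -[LHS]exprD addnC exprD.
congr (_ *: _); rewrite ['i%C ^+ (u' * v')%N * _]mulrC [v * u']mulrC.
rewrite [RHS]mulrC -[RHS]mulrA; congr (_ * _).
by rewrite mulrA -expr2 sqrr_sign mul1r.
Qed.

Lemma sigma_ind (Q : 'M[C]_2 -> Prop) :
  (forall M N, Q M -> Q N -> Q (M + N)) -> (forall c M, Q M -> Q (c *: M)) ->
  (forall u v, Q (sigma u v)) -> forall M, Q M.
Proof.
move=> QD QZ Qs M.
(* The coefficient of each Pauli matrix s is tr(s M) / 2. *)
have -> : M = 2^-1 *: ((M 0 0 + M 1 1) *: sigma 0 0 + (M 0 0 - M 1 1) *: sigma 0 1 +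
   (M 0 1 + M 1 0) *: sigma 1 0 + ('i%C * (M 0 1 - M 1 0)) *: sigma 1 1).
  have i2 : 'i%C * 'i%C = -1 :> C by rewrite -expr2 sqr_i.
  have E k l : sigma 1 1 k l = 'i%C * (k != l)%:R * (-1) ^+ l.
    rewrite sigma11 !mxE !big_ord_recl big_ord0 !mxE.
    case: k => [[|[|//]] ?]; case: l => [[|[|//]] ?];
    rewrite /= -?val_eqE /= ?mulr1n ?mulr0n ?expr0 ?expr1; ring.
  apply/matrixP=> i j.
  have ED (A B : 'M[C]_2) : (A + B) i j = A i j + B i j by rewrite mxE.
  have EZ c (A : 'M[C]_2) : (c *: A) i j = c * A i j by rewrite mxE.
  move: (E i j); move: (sigma 1 1) => s {}E.
  rewrite sigma00 sigma01 sigma10 !(EZ, ED) E !mxE.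
  have i2' (x : C) : 'i%C * x * 'i%C = - x by rewrite mulrAC i2 mulN1r.
  have half (x : C) : 2^-1 * (x + x) = x.
    by rewrite -[x + x]mulr2n -[x *+ 2]mulr_natl mulKf // pnatr_eq0.
  have [->|->] : i = 0 \/ i = 1.
    by case: i {E EZ ED} => [[|[|//]] ?]; [left|right]; exact/val_inj.
  - have [->|->] : j = 0 \/ j = 1.
      by case: j {E EZ ED} => [[|[|//]] ?]; [left|right]; exact/val_inj.
    + by rewrite /= ?(mulr1, mulr0, addr0, mulr1n) ?expr0 ?mulr1 addrACA subrr addr0 half.
    + rewrite /= ?mulr0n ?(mulr1, mulr0, addr0, add0r) ?expr1 ?mulrN1 mulrN i2' opprK.
      by rewrite addrACA subrr addr0 half.
  - have [->|->] : j = 0 \/ j = 1.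
      by case: j {E EZ ED} => [[|[|//]] ?]; [left|right]; exact/val_inj.
    + rewrite /= ?mulr0n ?(mulr1, mulr0, addr0, add0r) ?expr0 ?mulr1 i2' opprB.
      by rewrite [M 0 1 + _]addrC addrACA subrr addr0 half.
    + rewrite /= ?(mulr1, mulr0, addr0, mulr1n) ?expr1 ?mulrN1 opprB [M 0 0 + _]addrC.
      by rewrite ?oppr0 ?mulr0 ?addr0 addrACA subrr addr0 half.
have Qcs c u v : Q (c *: sigma u v) by exact/QZ/Qs.
exact: (QZ _ _ (QD _ _ (QD _ _ (QD _ _ (Qcs _ _ _) (Qcs _ _ _)) (Qcs _ _ _)) (Qcs _ _ _))).
Qed.

(** * The symplectic form and the n-qubit Paulis *)

Lemma sympC n (a b : pauli n) : symp a b = symp b a.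
Proof.
rewrite /symp addrC; congr (_ + _); apply: eq_bigr => i _; exact: mulrC.
Qed.

Lemma sympDr n (a b c : pauli n) : symp a (b + c) = symp a b + symp a c.
Proof.
rewrite /symp addrACA -!big_split /=.
by apply: eq_bigr => i _; rewrite !mxE !mulrDr.
Qed.

Lemma sympDl n (a b c : pauli n) : symp (a + b) c = symp a c + symp b c.
Proof. by rewrite sympC sympDr ![symp c _]sympC. Qed.

Lemma symp0r n (a : pauli n) : symp a 0 = 0.
Proof. by apply: (addrI (symp a 0)); rewrite -sympDr !addr0. Qed.

Lemma pauli_mx_dim0 (a : pauli 0) : pauli_mx R a = 1%:M.
Proof. by rewrite /pauli_mx big_ord0 expr0 scale1r /= mulmx1. Qed.

Lemma pauli_mx_adj n (a : pauli n) : (pauli_mx R a) ^t* = pauli_mx R a.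
Proof.
elim: n a => [|n IH] a; first by rewrite pauli_mx_dim0 trmx1 map_mx1.
by rewrite pauli_mxS kron_adj sigma_adj IH.
Qed.

Lemma pauli_mx_sq n (a : pauli n) : pauli_mx R a *m pauli_mx R a = 1%:M.
Proof.
elim: n a => [|n IH] a; first by rewrite pauli_mx_dim0 mulmx1.
by rewrite pauli_mxS kronM sigma_sq IH kron1.
Qed.

Lemma pauli_mx_comm n (a b : pauli n) : pauli_mx R a *m pauli_mx R b =
  (-1) ^+ symp a b *: (pauli_mx R b *m pauli_mx R a).
Proof.
elim: n a b => [|n IH] a b.
  by rewrite !pauli_mx_dim0 /symp !big_ord0 addr0 natF2 expr0 scale1r.
rewrite !pauli_mxS.
rewrite [LHS]kronM [X in _ = _ *: X]kronM IH sigma_comm kronZl kronZr scalerA sympS.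
by rewrite [in RHS]signF2D.
Qed.

Lemma pauli_mx0 n : pauli_mx R (0 : pauli n) = 1%:M.
Proof.
elim: n => [|n IH]; first exact: pauli_mx_dim0.
rewrite pauli_mxS !mxE sigma00 -(kron1 n) -IH; congr (kron _ (pauli_mx R _)).
by congr pair; apply/rowP=> i; rewrite !mxE.
Qed.

(** The Paulis span all matrices, being Kronecker products of spanning families; linear identities
    such as the twirl need only be checked on them. *)
Lemma pauli_mx_ind n (Q : 'M[C]_(2 ^ n) -> Prop) :
  (forall M N, Q M -> Q N -> Q (M + N)) -> (forall c M, Q M -> Q (c *: M)) ->
  (forall a, Q (pauli_mx R a)) -> forall M, Q M.
Proof.
elim: n Q => [|n IH] Q QD QZ QP.
  move=> M; have -> : M = M 0 0 *: pauli_mx R (0 : pauli 0).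
    by rewrite pauli_mx0; apply/matrixP=> i j; rewrite !ord1 !mxE eqxx mulr1.
  exact/QZ/QP.
apply: kron_ind => //; first by rewrite -(scale0r (pauli_mx R 0)); exact/QZ/QP.
move=> A B; move: A; apply: sigma_ind => [M N|c M|u v].
- by rewrite kronDl; exact: QD.
- by rewrite kronZl; exact: QZ.
move: B; apply: IH => [M N|c M|a].
- by rewrite kronDr; exact: QD.
- by rewrite kronZr; exact: QZ.
(* The Kronecker product of [sigma u v] and P_a is the Pauli whose label is a with the bits u, v put
   in front. *)
have := QP (row_mx (\row_(j < 1) u) a.1, row_mx (\row_(j < 1) v) a.2).
rewrite pauli_mxS /=.
have -> : row_mx (\row_(j < 1) u) a.1 0 0 = u.
  by rewrite (_ : 0 = lshift n (0 : 'I_1)) ?row_mxEl ?mxE //; exact/val_inj.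
have -> : row_mx (\row_(j < 1) v) a.2 0 0 = v.
  by rewrite (_ : 0 = lshift n (0 : 'I_1)) ?row_mxEl ?mxE //; exact/val_inj.
congr (Q (kron _ (pauli_mx R _))); case: a => x z.
have L (i : 'I_n) : lift ord0 i = rshift 1 i by exact/val_inj.
by rewrite /ptail /=; congr pair; apply/rowP=> i; rewrite mxE L; exact: row_mxEr.
Qed.

End PauliAlgebra.

(** * Twirling *)

Section Twirl.
Local Open Scope sesquilinear_scope.
Variable R : realType.
Local Notation C := R[i].

Lemma ReD (x y : C) : complex.Re (x + y) = complex.Re x + complex.Re y.
Proof. by case: x; case: y. Qed.

Lemma Re_sum (I : finType) (P : pred I) (F : I -> C) :
  complex.Re (\sum_(i | P i) F i) = \sum_(i | P i) complex.Re (F i).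
Proof. exact: (big_morph _ ReD (erefl _)). Qed.

Lemma Re_realM (r : R) (z : C) : complex.Re (r%:C%C * z) = r * complex.Re z.
Proof. by case: z => a b /=; rewrite mul0r subr0. Qed.

Lemma sign_realC (k : nat) : (-1) ^+ k = ((-1) ^+ k)%:C%C :> C.
Proof. by rewrite rmorphXn rmorphN rmorph1. Qed.

Lemma pauli_addxx n (a : pauli n) : a + a = 0.
Proof.
have F2xx (u : 'F_2) : u + u = 0.
  by case: (F2_cases u) => ->; rewrite ?addr0 ?addF2_11.
by case: a => x z; congr pair; apply/rowP=> i; rewrite !mxE F2xx.
Qed.

Lemma pauli_add_eq0 n (a b : pauli n) : (a + b == 0) = (a == b).
Proof.
have Nb : - b = b by apply/esym/eqP; rewrite -addr_eq0 pauli_addxx.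
by rewrite addr_eq0 Nb.
Qed.

Lemma adjmxD (m p : nat) (A B : 'M[C]_(m, p)) : (A + B) ^t* = A ^t* + B ^t*.
Proof. by apply/matrixP=> i j; rewrite !mxE rmorphD. Qed.

(** A nonzero bit of c at qubit i is detected by a single Z at that qubit if it lies in c_x, by a
    single X if it lies in c_z. *)
Lemma symp_nondegenerate n (c : pauli n) : c != 0 -> exists a, symp a c = 1.
Proof.
move=> c0; have [x0|] := eqVneq c.1 0; last first.
  move=> /rV0Pn[i ci]; exists (0, delta_mx 0 i).
  rewrite /symp big1 ?add0r => [|j _]; last by rewrite mxE mul0r.
  rewrite (bigD1 i) //= big1 => [|j ji]; last by rewrite mxE (negbTE ji) andbF mul0r.
  rewrite mxE !eqxx mul1r addr0.
  by case: (F2_cases (c.1 0 i)) ci => ->; rewrite ?eqxx.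
have : c.2 != 0.
  apply: contraNneq c0 => z0; rewrite [c]surjective_pairing x0 z0.
  exact/eqP.
move=> /rV0Pn[i ci]; exists (delta_mx 0 i, 0).
rewrite /symp [X in _ + X]big1 ?addr0 => [|j _]; last by rewrite mxE mul0r.
rewrite (bigD1 i) //= big1 => [|j ji]; last by rewrite mxE (negbTE ji) andbF mul0r.
rewrite mxE !eqxx mul1r addr0.
by case: (F2_cases (c.2 0 i)) ci => ->; rewrite ?eqxx.
Qed.

(** Orthogonality of characters: translating the summation index by some a0 with <a0, c> = 1 negates
    the sum. *)
Lemma symp_char_sum n (c : pauli n) :
  \sum_a (-1) ^+ symp a c = (#|{: pauli n}| * (c == 0))%:R :> C.
Proof.
have [->|c0] := eqVneq c 0.
  rewrite muln1 (eq_bigr (fun _ => 1)) => [|a _]; last by rewrite symp0r natF2 expr0.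
  by rewrite sumr_const.
have [a0 a0c] := symp_nondegenerate c0; rewrite muln0.
set s := LHS; have : s = - s.
  rewrite {1}/s (reindex_inj (addrI a0)) -sumrN; apply: eq_bigr => a _.
  by rewrite sympDl signF2D a0c natF2 expr1 mulN1r.
by move/eqP; rewrite -addr_eq0 -mulr2n mulrn_eq0 /= => /eqP.
Qed.

Lemma hsDr d (A B B' : 'M[C]_d) : hs A (B + B') = hs A B + hs A B'.
Proof. by rewrite /hs mulmxDr mxtraceD. Qed.

Lemma hsZr d c (A B : 'M[C]_d) : hs A (c *: B) = c * hs A B.
Proof. by rewrite /hs -scalemxAr mxtraceZ. Qed.

Lemma hs_sumr d (A : 'M[C]_d) (I : finType) (F : I -> 'M[C]_d) :
  hs A (\sum_i F i) = \sum_i hs A (F i).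
Proof.
by apply: (big_morph _ (hsDr A)); rewrite /hs mulmx0 mxtrace0.
Qed.

(** For a != b, conjugation by some P_c with <c, a + b> = 1 negates P_a P_b but preserves its trace,
    which therefore vanishes. *)
Lemma hs_pauli n (a b : pauli n) :
  hs (pauli_mx R a) (pauli_mx R b) = (2 ^ n * (a == b))%:R.
Proof.
rewrite /hs pauli_mx_adj; have [->|ab] := eqVneq a b.
  by rewrite pauli_mx_sq mxtrace1 muln1.
have [c cab] : exists c, symp c (a + b) = 1.
  by apply: symp_nondegenerate; rewrite pauli_add_eq0.
have comm2 (A B K : 'M[C]_(2 ^ n)) (e1 e2 : C) : K *m A = e1 *: (A *m K) ->
    K *m B = e2 *: (B *m K) -> K *m (A *m B) = (e1 * e2) *: (A *m B *m K).
  by move=> H1 H2; rewrite mulmxA H1 -scalemxAl -mulmxA H2 -scalemxAr scalerA mulmxA.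
have := comm2 _ _ _ _ _ (pauli_mx_comm R c a) (pauli_mx_comm R c b).
rewrite -signF2D -sympDr cab natF2 expr1 scaleN1r muln0.
move: (pauli_mx R a *m pauli_mx R b) (pauli_mx_sq R c) => M; move: (pauli_mx R c) => K K2 KM.
have t1 : \tr (K *m M *m K) = \tr M by rewrite mxtrace_mulC mulmxA K2 mul1mx.
have : \tr M = - \tr M by rewrite -{1}t1 KM mulNmx -mulmxA K2 mulmx1 raddfN.
by move/eqP; rewrite -addr_eq0 -mulr2n mulrn_eq0 /= => /eqP.
Qed.

Lemma pauli_channelD n (a : pauli n) (M N : 'M[C]_(2 ^ n)) :
  pauli_channel a (M + N) = pauli_channel a M + pauli_channel a N.
Proof. by rewrite /pauli_channel mulmxDr mulmxDl. Qed.

Lemma pauli_channelZ n (a : pauli n) c (M : 'M[C]_(2 ^ n)) :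
  pauli_channel a (c *: M) = c *: pauli_channel a M.
Proof. by rewrite /pauli_channel -scalemxAr -scalemxAl. Qed.

Lemma pauli_channel_pauli n (a b : pauli n) :
  pauli_channel a (pauli_mx R b) = (-1) ^+ symp a b *: pauli_mx R b.
Proof.
rewrite /pauli_channel pauli_mx_adj pauli_mx_comm -scalemxAl -mulmxA.
by rewrite pauli_mx_sq mulmx1.
Qed.

Lemma ketnorm n : ((sqrtC (2 ^ n)%N%:R)^-1)^* = (sqrtC (2 ^ n)%N%:R)^-1 :> C.
Proof.
by apply/CrealP; rewrite rpredV ger0_real // sqrtC_ge0 ler0n.
Qed.

Lemma hs_ketl n (a : pauli n) (M : 'M[C]_(2 ^ n)) :
  hs (pauli_ket R a) M = (sqrtC (2 ^ n)%N%:R)^-1 * hs (pauli_mx R a) M.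
Proof. by rewrite /hs /pauli_ket adjmxZ ketnorm -scalemxAl mxtraceZ. Qed.

Lemma ketnorm2 n :
  (sqrtC (2 ^ n)%N%:R)^-1 * (sqrtC (2 ^ n)%N%:R)^-1 = (2 ^ n)%:R^-1 :> C.
Proof. by rewrite -invfM -expr2 sqrtCK. Qed.

(** On M = P_b the channel of a acts as the sign (-1)^<a,b>, so the left side is the character sum
    at x + b, which is zero unless b = x. *)
Lemma twirl n (x : pauli n) (M : 'M[C]_(2 ^ n)) :
  \sum_a (-1) ^+ symp x a *: pauli_channel a M =
  (#|{: pauli n}|%:R * hs (pauli_ket R x) M) *: pauli_ket R x.
Proof.
move: M; apply: pauli_mx_ind => [M N EM EN|c M EM|b].
- rewrite hsDr mulrDr scalerDl -EM -EN -big_split /=; apply: eq_bigr => a _.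
  by rewrite pauli_channelD scalerDr.
- rewrite hsZr mulrCA -scalerA -EM scaler_sumr; apply: eq_bigr => a _.
  by rewrite pauli_channelZ !scalerA mulrC.
rewrite hs_ketl hs_pauli /pauli_ket scalerA.
under eq_bigr => a _.
  rewrite pauli_channel_pauli scalerA [symp x a]sympC -signF2D -sympDr; over.
rewrite -scaler_suml symp_char_sum.
rewrite pauli_add_eq0; have [->|xb] := eqVneq x b; last first.
  by rewrite !muln0 !(mul0r, mulr0, scale0r).
rewrite !muln1; congr (_ *: _).
rewrite -[LHS]mulr1 -!mulrA; congr (_ * _).
by rewrite mulrCA ketnorm2 mulfV // pnatr_eq0 expn_eq0.
Qed.

(** * Hermiticity of the noise and reality of the Pauli eigenvalues *)

Lemma psd_castmx d d' (e : d = d') (M : 'M[C]_d) : psd M -> psd (castmx (e, e) M).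
Proof. by case: _ / e. Qed.

(* Only the ampliation by a 1-dimensional space is used. *)
Lemma cp_psd_adj d (L : 'M[C]_d -> 'M[C]_d) (M : 'M[C]_d) :
  completely_positive L -> psd M -> (L M) ^t* = L M.
Proof.
move=> /(_ 1%N) cp /(psd_castmx (esym (mul1n d))) /cp[E _].
apply/matrixP=> p q; rewrite !mxE.
have := congr1 (fun A : 'M[C]_(1 * d) =>
  A (mxtens.mxtens_index (0, p)) (mxtens.mxtens_index (0, q))) E.
rewrite /ampliation !big_ord_recl !big_ord0 !addr0 !mxE !mxtens.mxtens_indexK /= !mul1r.
set M' := matrix_of_fun _ _; have -> // : M' = M.
apply/matrixP=> k l; rewrite mxE castmxE /= !esymK.
by congr (M _ _); exact/val_inj.
Qed.

(** Half of this matrix is a projector, because P_a is Hermitian and squares to 1. *)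
Lemma psd_1D_pauli n (a : pauli n) : psd (1%:M + pauli_mx R a).
Proof.
have herm : (1%:M + pauli_mx R a) ^t* = 1%:M + pauli_mx R a.
  by rewrite adjmxD trmx1 map_mx1 pauli_mx_adj.
split=> // v.
have -> : 1%:M + pauli_mx R a =
    2^-1 *: ((1%:M + pauli_mx R a) ^t* *m (1%:M + pauli_mx R a)).
  rewrite herm mulmxDl !mulmxDr pauli_mx_sq !mulmx1 mul1mx.
  rewrite [pauli_mx R a + 1%:M]addrC -[X in _ *: X]mulr2n.
  rewrite -[(_ + _) *+ 2]scaler_nat scalerA mulVf ?scale1r //.
rewrite -scalemxAr -scalemxAl mxE mulr_ge0 ?invr_ge0 ?ler0n //.
rewrite mulmxA -adjmxM -mulmxA; set w := _ *m v.
rewrite mxE sumr_ge0 // => i _; rewrite !mxE mulrC; exact: mul_conjC_ge0.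
Qed.

(** Complete positivity speaks of positive inputs, which P_a need not be; but P_a is the difference
    of 1 + P_a and 1, and 1 is half of 1 + P_0. *)
Lemma noise_pauli_adj n (N : gtm_noise R n) (a : pauli n) :
  (noise N (pauli_mx R a)) ^t* = noise N (pauli_mx R a).
Proof.
have E b : (noise N (1%:M + pauli_mx R b)) ^t* = noise N (1%:M + pauli_mx R b).
  by apply: cp_psd_adj; [exact: noise_cp|exact: psd_1D_pauli].
have E1 : (noise N 1%:M) ^t* = noise N 1%:M.
  have := E 0; rewrite pauli_mx0 -mulr2n -scaler_nat linearZ adjmxZ conjC_nat.
  by move/(scalerI (_ : 2 != 0)) => ->; rewrite ?pnatr_eq0.
by have := E a; rewrite linearD adjmxD E1 => /addrI.
Qed.

(** The trace of a product of two Hermitian matrices is real, so the [Re] in [eigval] loses nothing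
    and powers of f_x can be computed in the complex numbers. *)
Lemma eigvalE n (N : gtm_noise R n) (a : pauli n) :
  hs (pauli_ket R a) (noise N (pauli_ket R a)) = (eigval N a)%:C%C.
Proof.
rewrite /eigval; set z := hs _ _.
have zr : z^* = z.
  rewrite /z hs_ketl /pauli_ket linearZ hsZr; move: (ketnorm n).
  move: (sqrtC _)^-1 => k kr; rewrite rmorphM rmorphM /= kr; do 2!congr (_ * _).
  rewrite /hs pauli_mx_adj -[in LHS]noise_pauli_adj -mxtrace_tr.
  rewrite -trace_map_mx -[map_mx _ _]/(_ ^t*) adjmxM.
  by rewrite noise_pauli_adj noise_pauli_adj pauli_mx_adj mxtrace_mulC.
by case: z zr => x y [] /eqP; rewrite eq_sym -addr_eq0 -mulr2n mulrn_eq0 /= => /eqP ->.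
Qed.

(** Trace preservation. It makes the preset estimate 0 of the label 0 exact. *)
Lemma eigval0 n (N : gtm_noise R n) : eigval N 0 = 1.
Proof.
have: hs (pauli_ket R 0) (noise N (pauli_ket R 0)) = 1.
  rewrite hs_ketl /pauli_ket linearZ hsZr mulrA ketnorm2 pauli_mx0 /hs trmx1 map_mx1 mul1mx.
  by rewrite noise_tp mxtrace1 mulVf // pnatr_eq0 expn_eq0.
by rewrite eigvalE => -[].
Qed.

End Twirl.

(** * The law of RunCB *)

Section RunCB.
Variable R : realType.
Local Notation C := R[i].

Lemma pauli_norm n (S : {group pauli n}) (c : pauli n) : c \in 'N(centr S)%g.
Proof.
have abT : abelian [set: pauli n]%SET by apply/centsP=> a _ b _; exact: addrC.
by apply: (fintype.subsetP (sub_abelian_norm abT (finset.subsetT _))); rewrite inE.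
Qed.

Lemma centrP n (S : {group pauli n}) (c h : pauli n) :
  c \in centr S -> h \in S -> symp h c = 0.
Proof. by rewrite inE => /forall_inP cS /cS /eqP; rewrite sympC. Qed.

(** The chosen representative differs from c by an element of [centr S], which is orthogonal to
    h. *)
Lemma sympq_coset n (S : {group pauli n}) (h c : pauli n) :
  h \in S -> sympq h (coset (centr S) c : syndrome S) = symp h c.
Proof.
move=> hS; rewrite /sympq.
have := mem_repr_coset (coset (centr S) c); rewrite val_coset ?pauli_norm //.
case/rcosetP => g gS ->.
have -> : symp h (g * c)%g = symp h g + symp h c by exact: sympDr.
by rewrite (centrP gS hS) add0r.
Qed.

Lemma sympqM n (S : {group pauli n}) (h : pauli n) (b z : syndrome S) :
  h \in S -> sympq h (b * z)%g = sympq h b + sympq h z.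
Proof.
move=> hS; rewrite -(coset_reprK b) -(coset_reprK z) -morphM ?pauli_norm //.
by rewrite !sympq_coset // -sympDr.
Qed.

Lemma big_cons_tuple (V : nmodType) (T : finType) k (F : k.+1.-tuple T -> V) :
  \sum_(a : k.+1.-tuple T) F a = \sum_c \sum_(a : k.-tuple T) F [tuple of c :: a].
Proof.
rewrite pair_big /= (reindex (fun p : T * k.-tuple T => [tuple of p.1 :: p.2])) //=.
exists (fun a => (thead a, [tuple of behead a])) => [[c a] _|a _] /=.
  by rewrite theadE; congr pair; exact/val_inj.
by rewrite [RHS]tuple_eta.
Qed.

Section Circuit.
Variables (n : nat) (N : gtm_noise R n).

Let step (M : 'M[C]_(2 ^ n)) (c : pauli n) := pauli_channel c (noise N M).

Lemma foldl_stepD (a : seq (pauli n)) M M' :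
  foldl step (M + M') a = foldl step M a + foldl step M' a.
Proof.
elim: a M M' => //= c a IH M M'.
have -> : step (M + M') c = step M c + step M' c.
  by rewrite /step linearD pauli_channelD.
exact: IH.
Qed.

Lemma foldl_stepZ (a : seq (pauli n)) e M :
  foldl step (e *: M) a = e *: foldl step M a.
Proof.
elim: a M => //= c a IH M.
have -> : step (e *: M) c = e *: step M c by rewrite /step linearZ pauli_channelZ.
exact: IH.
Qed.

Lemma foldl_step_sum (I : finType) (F : I -> 'M[C]_(2 ^ n)) (a : seq (pauli n)) :
  foldl step (\sum_i F i) a = \sum_i foldl step (F i) a.
Proof.
apply: (big_morph (fun M => foldl step M a)) => [M M'|]; first exact: foldl_stepD.
by have := foldl_stepZ a 0 0; rewrite !scale0r.
Qed.

(** The sign is multiplicative in the gates, so summing over the first gate twirls the noisy image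
    of M; what is left is a multiple of |x), from which the remaining gates start. *)
Lemma signed_circuit_sumS (x : pauli n) k M :
  \sum_(a : k.+1.-tuple (pauli n)) (-1) ^+ symp x (\sum_(c <- a) c) *: foldl step M a =
  (#|{: pauli n}|%:R * hs (pauli_ket R x) (noise N M)) *:
  \sum_(a : k.-tuple (pauli n))
    (-1) ^+ symp x (\sum_(c <- a) c) *: foldl step (pauli_ket R x) a.
Proof.
rewrite big_cons_tuple exchange_big scaler_sumr; apply: eq_bigr => a _.
rewrite scalerA mulrC -scalerA -foldl_stepZ -twirl foldl_step_sum scaler_sumr.
apply: eq_bigr => c _; rewrite foldl_stepZ scalerA big_cons sympDr signF2D.
by rewrite mulrC.
Qed.

(** The first gate yields the preparation factor (x|noise|M) and each of the other m gates a factor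
    f_x: hence the exponent m with m + 1 gates. *)
Lemma signed_circuit_sum (x : pauli n) m M :
  \sum_(a : m.+1.-tuple (pauli n)) (-1) ^+ symp x (\sum_(c <- a) c) *: foldl step M a =
  (#|{: pauli n}|%:R ^+ m.+1 * (hs (pauli_ket R x) (noise N M) * (eigval N x ^+ m)%:C%C)) *:
  pauli_ket R x.
Proof.
rewrite signed_circuit_sumS exprS -mulrA -scalerA -[RHS]scalerA; congr (_ *: _).
rewrite mulrCA -[RHS]scalerA; congr (_ *: _).
elim: m => [|m IH].
  rewrite (big_pred1 [tuple]) => [|a]; last by apply/esym/eqP; exact: tuple0.
  by rewrite big_nil symp0r natF2 !expr0 mul1r.
rewrite signed_circuit_sumS IH eigvalE scalerA !exprS rmorphM; congr (_ *: _).
by rewrite mulrACA.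
Qed.

(** Gates and syndrome b determine z, and the sign of z is the product of theirs. The sign of the
    gates is moved inside the state, where only |x) survives; pairing it with the POVM restores the
    measurement factor of [spam]. *)
Lemma runcb_expectation (S : {group pauli n}) (m : nat) (x : pauli n) : x \in S ->
  \sum_z runcb_pmf N m z * (-1) ^+ sympq x (z : syndrome S) =
  spam N S x * eigval N x ^+ m.
Proof.
move=> xS; rewrite /runcb_pmf.
transitivity (\sum_(a : m.+1.-tuple (pauli n)) #|{: pauli n}|%:R ^- m.+1 *
   \sum_(b : syndrome S) (-1) ^+ sympq x b * (-1) ^+ symp x (\sum_(c <- a) c)
     * complex.Re (hs (povm N b) (circuit N S a))).
  under eq_bigr do rewrite mulr_suml.
  rewrite exchange_big; apply: eq_bigr => a _.
  under eq_bigr do rewrite -mulrA.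
  rewrite -mulr_sumr; congr (_ * _).
  under eq_bigr do rewrite mulr_suml.
  rewrite (exchange_big_dep predT) //; apply: eq_bigr => b _.
  rewrite (big_pred1 (b * coset (centr S) (\sum_(c <- a) c))%g) => [|z]; last first.
    by rewrite /= eq_sym.
  by rewrite sympqM // sympq_coset // signF2D mulrC.
under eq_bigr do rewrite mulr_sumr.
rewrite exchange_big /spam Re_sum mulr_suml; apply: eq_bigr => b _.
transitivity (complex.Re (\sum_(a : m.+1.-tuple (pauli n))
   (#|{: pauli n}|%:R ^- m.+1 * (-1) ^+ sympq x b * (-1) ^+ symp x (\sum_(c <- a) c)
   : R)%:C%C * hs (povm N b) (circuit N S a))).
  by rewrite Re_sum; apply: eq_bigr => a _; rewrite Re_realM !mulrA.
transitivity (complex.Re ((#|{: pauli n}|%:R ^- m.+1 * (-1) ^+ sympq x b : R)%:C%C *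
   hs (povm N b) (\sum_(a : m.+1.-tuple (pauli n))
       (-1) ^+ symp x (\sum_(c <- a) c) *: circuit N S a))).
  congr complex.Re; rewrite hs_sumr mulr_sumr; apply: eq_bigr => a _.
  by rewrite hsZr sign_realC mulrA -rmorphM.
rewrite signed_circuit_sum.
rewrite (hsZr _ (povm N b) (pauli_ket R x)) sign_realC.
have -> : #|{: pauli n}|%:R ^+ m.+1 = (#|{: pauli n}|%:R ^+ m.+1)%:C%C :> C.
  by rewrite rmorphXn rmorph_nat.
set k := hs (pauli_ket R x) _; set h := hs _ _.
rewrite Re_realM -!mulrA Re_realM [h * _]mulrC.
rewrite (_ : (k * ((eigval N x ^+ m)%:C%C * h)) = (eigval N x ^+ m)%:C%C * (h * k)).
  rewrite !Re_realM mulrCA [RHS]mulrC [_^-1 * _]mulrA mulrA mulVf ?mul1r.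
    by rewrite mulr1 [k * h]mulrC mulrCA.
  by rewrite expf_neq0 // pnatr_eq0 -lt0n; apply/card_gt0P; exists 0.
by rewrite mulrCA; congr (_ * _); rewrite mulrC.
Qed.

End Circuit.
End RunCB.

(** * Concentration of the estimates *)

Section Hoeffding.
Variable R : realType.

(** From exp(-y) >= 1 - y, since (1 + y + 2 y^2) (1 - y) = 1 + y^2 (1 - 2 y) >= 1. *)
Lemma expR_le_quad (y : R) : y <= 2^-1 -> expR y <= 1 + y + 2 * y ^+ 2.
Proof.
move=> y2; have h := expR_ge1Dx (- y); rewrite expRN in h.
have y1 : 0 < 1 - y by lra.
have e0 := expR_gt0 y.
have : expR y * (1 - y) <= 1.
  by rewrite -[leRHS](mulfV (lt0r_neq0 e0)) ler_wpM2l // ltW.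
move=> h1; rewrite -(ler_pM2r y1); apply: (le_trans h1).
by rewrite expr2; nra.
Qed.

Variables (I : finType) (p s : I -> R).
Hypotheses (p_ge0 : forall i, 0 <= p i) (p_sum : \sum_i p i = 1).
Hypothesis s_le1 : forall i, `|s i| <= 1.
Let mu := \sum_i p i * s i.

Lemma mean_le1 : `|mu| <= 1.
Proof.
rewrite (le_trans (ler_norm_sum _ _ _)) // -p_sum ler_sum // => i _.
by rewrite normrM ger0_norm // ler_piMr.
Qed.

(** As |s - mu| <= 2, the bound [eps] <= 1/4 keeps the exponent below 1/2. In the quadratic bound
    the linear term averages to zero and the variance is at most 1. *)
Lemma mgf_le (eps : R) : 0 <= eps <= 4^-1 ->
  \sum_i p i * expR (eps * (s i - mu)) <= expR (2 * eps ^+ 2).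
Proof.
move=> /andP[eps0 eps4]; apply: le_trans (expR_ge1Dx _).
apply: (@le_trans _ _ (\sum_i p i * (1 + eps * (s i - mu) + 2 * (eps * (s i - mu)) ^+ 2))).
  apply: ler_sum => i _; apply: ler_wpM2l => //; apply: expR_le_quad.
  have := s_le1 i; have := mean_le1; rewrite !ler_norml => /andP[? ?] /andP[? ?].
  nra.
have -> : forall c : R, \sum_i p i * (1 + eps * (s i - c) + 2 * (eps * (s i - c)) ^+ 2) =
    \sum_i p i + eps * (\sum_i p i * s i) - eps * c * (\sum_i p i)
    + 2 * eps ^+ 2 * (\sum_i p i * s i ^+ 2) - 4 * eps ^+ 2 * c * (\sum_i p i * s i)
    + 2 * eps ^+ 2 * c ^+ 2 * (\sum_i p i).
  move=> c.
  by rewrite !mulr_sumr -!sumrN -!big_split /=; apply: eq_bigr => i _; ring.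
rewrite -/mu p_sum.
have : \sum_i p i * s i ^+ 2 <= 1.
  rewrite -p_sum ler_sum // => i _; rewrite ler_piMr // -real_normK ?num_real //.
  by rewrite expr_le1.
move=> h; have : 0 <= eps ^+ 2 * mu ^+ 2 by rewrite mulr_ge0 ?sqr_ge0.
have : 0 <= eps ^+ 2 * (1 - \sum_i p i * s i ^+ 2) by rewrite mulr_ge0 ?sqr_ge0 ?subr_ge0.
rewrite !expr2; nra.
Qed.

(* The tolerance 3 eps, rather than eps, leaves room for the crude bound of
   expR_le_quad on the exponential moment in place of Hoeffding's lemma. *)
Lemma hoeffding_upper (t : nat) (eps : R) : 0 <= eps <= 4^-1 ->
  \sum_(f : {ffun 'I_t -> I} | 3 * eps * t%:R <= \sum_k (s (f k) - mu)) \prod_k p (f k)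
  <= expR (- (eps ^+ 2 * t%:R)).
Proof.
move=> heps; have /andP[eps0 _] := heps.
(* Chernoff bound with tilt [eps]: on the event, exp(eps * sum) is at least exp(3 eps^2 t).
   Independence then factors the sum over f, and 3 - 2 = 1 gives the exponent. *)
apply: (@le_trans _ _ (expR (- (3 * eps ^+ 2 * t%:R)) *
   \sum_(f : {ffun 'I_t -> I}) \prod_k (p (f k) * expR (eps * (s (f k) - mu))))).
  rewrite mulr_sumr big_mkcond /=; apply: ler_sum => f _.
  have pf0 : 0 <= \prod_k p (f k) by exact: prodr_ge0.
  rewrite [\prod_k (_ * _)]big_split /= -expR_sum -mulr_sumr mulrCA -expRD.
  case: ifP => hf; last by rewrite mulr_ge0 // expR_ge0.
  rewrite ler_peMr // -[leLHS]expR0 ler_expR.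
  have := ler_wpM2l eps0 hf; rewrite expr2; lra.
rewrite -(bigA_distr_bigA (fun (k : 'I_t) i => p i * expR (eps * (s i - mu)))) /=.
rewrite prodr_const card_ord.
apply: (@le_trans _ _ (expR (- (3 * eps ^+ 2 * t%:R)) * expR (2 * eps ^+ 2) ^+ t)).
  rewrite ler_wpM2l ?expR_ge0 // lerXn2r ?mgf_le ?nnegrE ?expR_ge0 //.
  by apply: sumr_ge0 => i _; rewrite mulr_ge0 // expR_ge0.
by rewrite -expRM_natr -expRD ler_expR; lra.
Qed.

End Hoeffding.

Section Concentration.
Variable R : realType.

(** The lower tail is the upper tail of -s, whose mean is -mu. *)
Lemma hoeffding_two_sided (I : finType) (p s : I -> R) (t : nat) (eps : R) :
  (forall i, 0 <= p i) -> \sum_i p i = 1 -> (forall i, `|s i| <= 1) ->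
  0 <= eps <= 4^-1 -> (0 < t)%N ->
  \sum_(f : {ffun 'I_t -> I} |
      3 * eps <= `|t%:R^-1 * (\sum_k s (f k)) - \sum_i p i * s i|) \prod_k p (f k)
  <= 2 * expR (- (eps ^+ 2 * t%:R)).
Proof.
move=> p0 p1 s1 heps t0; set mu := \sum_i p i * s i.
have s1' i : `|- s i| <= 1 by rewrite normrN.
have h1 := hoeffding_upper p0 p1 s1 t heps; rewrite -/mu in h1.
have h2 := hoeffding_upper p0 p1 s1' t heps.
have mu' : \sum_i p i * - s i = - mu by rewrite -sumrN; apply: eq_bigr => i _; rewrite mulrN.
rewrite mu' in h2; clearbody mu.
rewrite [leRHS]mulr_natl [leRHS]mulr2n; apply: le_trans (lerD h1 h2).
rewrite big_mkcond [X in _ <= X + _]big_mkcond [X in _ <= _ + X]big_mkcond /=.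
rewrite -big_split /=; apply: ler_sum => f _.
have pf0 : 0 <= \prod_k p (f k) by exact: prodr_ge0.
have t0' : 0 < t%:R :> R by rewrite ltr0n.
have E1 : \sum_(k < t) (s (f k) - mu) = t%:R * (t%:R^-1 * (\sum_k s (f k)) - mu).
  by rewrite mulrBr mulVKf ?gt_eqF // sumrB sumr_const card_ord mulr_natl.
have E2 : \sum_(k < t) (- s (f k) - - mu) = t%:R * - (t%:R^-1 * (\sum_k s (f k)) - mu).
  by rewrite mulrN -E1 -sumrN; apply: eq_bigr => k _; rewrite opprD.
rewrite E1 E2 ![3 * eps * _]mulrC !ler_pM2l // ler_normr.
by move: (3 * eps <= - _) (3 * eps <= _) => [] [] /=; rewrite ?addr0 ?add0r ?lerDl.
Qed.

Lemma prob_bigcup_le d (T : measurableType d) (P : probability T R) (I : choiceType)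
    (s : seq I) (F : I -> set T) (q : I -> R) (A : set T) :
  uniq s -> measurable A -> (forall i, i \in s -> measurable (F i)) ->
  (forall i, i \in s -> (P (F i) <= (q i)%:E)%E) ->
  (forall w, A w -> exists2 i, i \in s & F i w) ->
  (P A <= (\sum_(i <- s) q i)%:E)%E.
Proof.
move=> us mA mF Fq As.
apply: (@le_trans _ _ (\sum_(i \in [set` s]) P (F i))%E).
  by apply: content_sub_fsum => // w /As[i ? ?]; exists i.
rewrite -fsbig_seq // -sumEFin big_seq [leRHS]big_seq.
by apply: lee_sum => i; exact: Fq.
Qed.

Section Samples.
Variables (n : nat) (N : gtm_noise R n) (d : measure_display) (T : measurableType d).
Variables (P : probability T R)
  (Z : forall S : {group pauli n}, nat -> nat -> T -> syndrome S).
Hypothesis HZ : runcb_samples N P Z.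
Variables (S : {group pauli n}) (m : nat).
Hypothesis stabS : stabilizer S.

(** Independence of the calls enters only through the probability of these events. *)
Definition cylinder (t : nat) (f : {ffun 'I_t -> syndrome S}) : set T :=
  [set w | forall k : 'I_t, Z S m k w = f k]%classic.

(* runcb_samples quantifies over tables indexed by all groups, so f has to be
   extended to the other groups. *)
Lemma syndrome_family (t : nat) (f : {ffun 'I_t -> syndrome S}) :
  exists z : forall S' : {group pauli n}, nat -> nat -> syndrome S',
    forall k : 'I_t, z S m k = f k.
Proof.
exists (fun S' _ k => match S =P S' with
  | ReflectT e => ecast S0 (syndrome S0) e (if insub k is Some k' then f k' else 1%g)
  | ReflectF _ => 1%g end) => k.
by case: eqP => // e; rewrite (eq_axiomK e) /= valK.
Qed.

Lemma cylinderE t (f : {ffun 'I_t -> syndrome S}) :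
  cylinder f = (\bigcap_(k in [set` enum 'I_t]) (Z S m k @^-1` [set f k]))%classic.
Proof.
apply/seteqP; split=> [w cw k _|w cw k]; first exact: cw.
by apply: (cw k); rewrite /= mem_enum.
Qed.

Lemma measurable_cylinder t (f : {ffun 'I_t -> syndrome S}) : measurable (cylinder f).
Proof.
rewrite cylinderE; apply: fin_bigcap_measurable => [|k _]; first exact: finite_seq.
exact: HZ.1.
Qed.

Lemma prob_cylinder t (f : {ffun 'I_t -> syndrome S}) :
  P (cylinder f) = (\prod_k runcb_pmf N m (f k))%:E.
Proof.
have [z zf] := syndrome_family f.
have := HZ.2 [seq (S, m, val k) | k <- enum 'I_t] z.
rewrite map_inj_uniq => [|k k' [/val_inj //]]; rewrite enum_uniq => /(_ isT) H.
have {}H := H (fun i => _); rewrite big_map big_enum /= in H.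
under eq_bigr do rewrite -zf.
rewrite -H => [|i /mapP[k _ ->] //]; congr (P _).
rewrite cylinderE; apply/seteqP; split=> w cw.
  by move=> i /mapP[k _ ->] /=; rewrite zf; apply: cw; rewrite /= mem_enum.
move=> k _ /=; rewrite -zf; apply: (cw (S, m, val k)).
by apply/mapP; exists k; rewrite ?mem_enum.
Qed.

(** With t = 1 a cylinder fixes a single outcome, so positivity and normalisation of the law are
    inherited from [P]. *)
Lemma runcb_pmf_prob (b : syndrome S) :
  P (cylinder [ffun _ : 'I_1 => b]) = (runcb_pmf N m b)%:E.
Proof. by rewrite prob_cylinder big_ord1 ffunE. Qed.

Lemma runcb_pmf_ge0 (b : syndrome S) : 0 <= runcb_pmf N m b.
Proof. by rewrite -lee_fin -runcb_pmf_prob measure_ge0. Qed.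

Lemma runcb_pmf_sum : \sum_(b : syndrome S) runcb_pmf N m b = 1.
Proof.
pose F (b : syndrome S) := cylinder [ffun _ : 'I_1 => b].
have E : (\bigcup_(b in [set` enum {: syndrome S}]) F b)%classic = setT.
  apply/seteqP; split=> // w _; exists (Z S m 0%N w); first by rewrite /= mem_enum.
  by move=> k; rewrite ord1 ffunE.
have := probability_setT P; rewrite -E measure_fin_bigcup.
- rewrite -fsbig_seq ?enum_uniq // big_enum /=.
  under eq_bigr do rewrite runcb_pmf_prob.
  by rewrite sumEFin => -[].
- exact: finite_seq.
- move=> b b' _ _ [w [/(_ ord0) + /(_ ord0)]]; rewrite !ffunE => <- <- //.
- by move=> b _; exact: measurable_cylinder.
Qed.

(** The deviation depends only on the t outcomes at (S, m), so the event is a finite union of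
    cylinders, whose total weight is the sum bounded by Hoeffding. *)
Lemma estimate_deviation (t : nat) (x : pauli n) (eps : R) : x \in S ->
  0 <= eps <= 4^-1 -> (0 < t)%N ->
  let bad := [set w | 3 * eps <= `|estV R (fun S m k => Z S m k w) t S m x -
                          spam N S x * eigval N x ^+ m|]%classic in
  measurable bad /\ (P bad <= (2 * expR (- (eps ^+ 2 * t%:R)))%:E)%E.
Proof.
move=> xS heps t0 bad.
pose s (b : syndrome S) : R := (-1) ^+ sympq x b.
have s1 b : `|s b| <= 1 by rewrite normrX normrN1 expr1n.
pose badf (f : {ffun 'I_t -> syndrome S}) :=
  3 * eps <= `|t%:R^-1 * (\sum_k s (f k)) - \sum_b runcb_pmf N m b * s b|.
have badE w : bad w <-> exists2 f, f \in enum badf & cylinder f w.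
  rewrite /bad /= -(runcb_expectation N m xS) -/s.
  split=> [bw|[f]].
    exists [ffun k : 'I_t => Z S m k w]; last by move=> k; rewrite ffunE.
    rewrite mem_enum; apply: le_trans bw _; rewrite /estV.
    by under [in leRHS]eq_bigr do rewrite ffunE.
  rewrite mem_enum => bf cf; apply: le_trans bf _; rewrite /estV.
  by under [in leLHS]eq_bigr do rewrite -cf.
have mbad : measurable bad.
  have -> : bad = (\bigcup_(f in [set` enum badf]) cylinder f)%classic.
    by apply/seteqP; split=> w /=; rewrite badE.
  apply: fin_bigcup_measurable => [|f _]; first exact: finite_seq.
  exact: measurable_cylinder.
split=> //; apply: (@le_trans _ _ (\sum_(f <- enum badf) \prod_k runcb_pmf N m (f k))%:E).
  apply: (@prob_bigcup_le _ _ _ _ _ (@cylinder t)) => //.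
  - exact: enum_uniq.
  - by move=> f _; exact: measurable_cylinder.
  - by move=> f _; rewrite prob_cylinder.
  - by move=> w /badE.
rewrite lee_fin big_enum /=; apply: hoeffding_two_sided => //.
  exact: runcb_pmf_ge0.
exact: runcb_pmf_sum.
Qed.

(** The left side is the mean of a sign; at m = 0 this bounds the SPAM parameter itself. *)
Lemma spam_le1 (x : pauli n) : x \in S -> spam N S x * eigval N x ^+ m <= 1.
Proof.
move=> xS; rewrite -runcb_expectation // -[leRHS]runcb_pmf_sum ler_sum // => b _.
apply: ler_piMr; first exact: runcb_pmf_ge0.
by rewrite (le_trans (ler_norm _)) // normrX normrN1 expr1n.
Qed.

End Samples.
End Concentration.

(** * Accuracy of the ratio of two estimates *)

Section Numeric.
Variable R : realType.

Lemma bernoulli (u : R) (m : nat) : -1 <= u -> 1 + m%:R * u <= (1 + u) ^+ m.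
Proof.
move=> u1; elim: m => [|m IH]; first by rewrite mul0r addr0 expr0.
rewrite exprS; have u0 : 0 <= 1 + u by lra.
apply: le_trans (ler_wpM2l u0 IH); rewrite -natr1.
have : 0 <= m%:R * (u * u) by rewrite mulr_ge0 // -expr2 sqr_ge0.
nra.
Qed.

(** With u = 2 y / m, Bernoulli gives (1 + u)^m >= 1 + 2 y. For the lower side, (1 - u)(1 + u) <= 1
    turns this into (1 - u)^m <= 1 / (1 + 2 y) <= 1 - y, as y <= 1/2. *)
Lemma root_perturb (f q y : R) (m : nat) : (0 < m)%N -> 0 <= f <= 1 -> 0 <= q ->
  0 <= y <= 2^-1 -> f ^+ m * (1 - y) <= q ^+ m <= f ^+ m * (1 + y) ->
  `|q - f| <= 2 * y / m%:R.
Proof.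
move=> m0 /andP[f0 f1] q0 /andP[y0 y1] /andP[lo hi].
have mR : 0 < m%:R :> R by rewrite ltr0n.
have m1 : 1 <= m%:R :> R by rewrite ler1n.
set u := 2 * y / m%:R.
have mu : m%:R * u = 2 * y by rewrite /u mulrC divfK ?gt_eqF.
have u0 : 0 <= u by rewrite divr_ge0 ?mulr_ge0.
have u1 : u <= 1 by rewrite ler_pdivrMr // mul1r; lra.
have g0 : 0 <= f ^+ m by rewrite exprn_ge0.
have up : q <= f * (1 + u).
  rewrite -(ler_pXn2r m0) ?nnegrE ?mulr_ge0 //; last lra.
  apply: (le_trans hi); rewrite exprMn ler_wpM2l //.
  have := @bernoulli u m; rewrite mu => h; apply: le_trans (h _); lra.
have dn : f * (1 - u) <= q.
  rewrite -(ler_pXn2r m0) ?nnegrE ?mulr_ge0 //; last lra.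
  apply: le_trans lo; rewrite exprMn ler_wpM2l //.
  have h1 : 1 + 2 * y <= (1 + u) ^+ m.
    by have := @bernoulli u m; rewrite mu; apply; lra.
  have h2 : (1 - u) ^+ m * (1 + u) ^+ m <= 1.
    rewrite -exprMn exprn_ile1 //; nra.
  have h3 : 0 <= (1 - u) ^+ m by rewrite exprn_ge0 //; lra.
  have h4 : (1 - u) ^+ m * (1 + 2 * y) <= 1 by apply: le_trans h2; rewrite ler_wpM2l.
  have h5 : 0 < 1 + 2 * y by lra.
  rewrite -(ler_pM2r h5); apply: (le_trans h4); nra.
have fu : f * u <= u by rewrite ler_piMl.
rewrite ler_norml; apply/andP; split; lra.
Qed.

Lemma baseline_gt0 (eta A v : R) : eta <= 200^-1 -> 2^-1 <= A -> `|v - A| <= eta -> 0 < v.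
Proof. by move=> eta_le A_ge v_near; move: v_near; rewrite ler_norml => /andP[]; lra. Qed.

(** 9/100 is the square of 3/10: the decay still guaranteed one doubling after a failed test. *)
Lemma decayed_gt0 (eta A g w : R) : eta <= 200^-1 -> 2^-1 <= A ->
  `|w - A * g| <= eta -> 9 / 100 <= g -> 0 < w.
Proof.
move=> eta_le A_ge w_near g_ge; move: w_near; rewrite ler_norml => /andP[] ? _.
have : A * (9 / 100) <= A * g by rewrite ler_wpM2l //; lra.
lra.
Qed.

(** The errors of w and v/3 add up to 4 eta / 3 <= 1/150, less than the margin A / 30 >= 1/60
    between 1/3 and 3/10. *)
Lemma not_stopped (eta A g v w : R) : eta <= 200^-1 -> 2^-1 <= A ->
  `|v - A| <= eta -> `|w - A * g| <= eta -> v / 3 < w -> 3 / 10 <= g.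
Proof.
move=> eta_le A_ge v_near w_near vw; have A0 : 0 < A by lra.
rewrite -(ler_pM2l A0).
move: w_near v_near; rewrite !ler_norml => /andP[? ?] /andP[? ?]; lra.
Qed.

Lemma stopped (eta A g v w : R) : eta <= 200^-1 -> 2^-1 <= A ->
  `|v - A| <= eta -> `|w - A * g| <= eta -> g <= 4^-1 -> w <= v / 3.
Proof.
move=> eta_le A_ge v_near w_near g_le; have : A * g <= A * 4^-1 by rewrite ler_wpM2l //; lra.
move: w_near v_near; rewrite !ler_norml => /andP[? ?] /andP[? ?]; lra.
Qed.

Lemma stopped_accuracy (eta A f v w : R) (m : nat) :
  0 < eta <= 200^-1 -> 2^-1 <= A <= 1 -> 2^-1 <= f <= 1 -> (0 < m)%N ->
  `|v - A| <= eta -> `|w - A * f ^+ m| <= eta -> 9 / 100 <= f ^+ m -> w <= v / 3 ->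
  `|1 - (w / v) `^ m%:R^-1 - (1 - f)| <= 224 * eta * (1 - f).
Proof.
move=> /andP[eta_gt0 eta_le] /andP[A_ge A_le] /andP[f_ge f_le] m_gt0 v_near w_near g wv.
have v0 := baseline_gt0 eta_le A_ge v_near; have w0 := decayed_gt0 eta_le A_ge w_near g.
have mR : 0 < m%:R :> R by rewrite ltr0n.
have mN0 : m%:R != 0 :> R by rewrite gt_eqF.
set q := _ `^ _; have q0 : 0 <= q by exact: powR_ge0.
have qm : q ^+ m = w / v.
  by rewrite -powR_mulrn // -powRrM mulVf // powRr1 // ltW // divr_gt0.
have g1 : f ^+ m <= 1 by rewrite exprn_ile1 //; lra.
have /andP[w1 w2] : - eta <= w - A * f ^+ m <= eta by rewrite -ler_norml.
have /andP[v1 v2] : - eta <= v - A <= eta by rewrite -ler_norml.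
have gv1 : f ^+ m * v <= f ^+ m * (A + eta) by rewrite ler_wpM2l; lra.
have gv2 : f ^+ m * (A - eta) <= f ^+ m * v by rewrite ler_wpM2l; lra.
have ge : f ^+ m * eta <= eta by rewrite ler_piMl // ltW.
(* w differs from f^m v by at most 2 eta, and f^m v exceeds 2/56; so w/v has relative error at most
   56 eta, and 224 is 2 * 56 * 2. *)
have egv : 2 * eta <= 56 * eta * (f ^+ m * v).
  have : 9 / 100 * (2^-1 - 200^-1) <= f ^+ m * v by apply: ler_pM; lra.
  nra.
have pert : `|q - f| <= 2 * (56 * eta) / m%:R.
  apply: root_perturb => //; [lra|lra|].
  rewrite qm ler_pdivrMr // ler_pdivlMr //; apply/andP; split; nra.
have half : f ^+ m <= 2^-1.
  have A0 : 0 < A by lra.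
  by rewrite -(ler_pM2l A0); lra.
have mr : 2^-1 <= m%:R * (1 - f).
  have := @bernoulli (f - 1) m; rewrite (_ : 1 + (f - 1) = f); last by lra.
  by move=> h; have {}h := h ltac:(lra); lra.
have mi : m%:R^-1 <= 2 * (1 - f).
  rewrite -(ler_pM2l mR) mulfV //; lra.
rewrite (_ : 1 - q - (1 - f) = - (q - f)); last by lra.
rewrite normrN; apply: (le_trans pert).
have : 2 * (56 * eta) * m%:R^-1 <= 2 * (56 * eta) * (2 * (1 - f)).
  by rewrite ler_wpM2l //; lra.
by lra.
Qed.

End Numeric.

(** * Runs of Ratio *)

(** Includes 0 for the baseline call of [V], hence J + 2 entries; this count bounds |kappa|. *)
Definition lengths (J : nat) : seq nat := 0%N :: [seq (2 ^ i)%N | i <- iota 0 J.+1].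

Lemma lengths_uniq J : uniq (lengths J).
Proof.
rewrite /lengths cons_uniq map_inj_uniq ?iota_uniq ?andbT; last first.
  by move=> i j /eqP; rewrite eqn_exp2l // => /eqP.
by apply/negP => /mapP[i _ /esym/eqP]; rewrite expn_eq0.
Qed.

Lemma lengths_le J m : m \in lengths J -> (m <= 2 ^ J)%N.
Proof.
rewrite in_cons => /orP[/eqP -> //|mJ]; have [i ii ->] := mapP mJ.
by move: ii; rewrite mem_iota /= add0n ltnS => iJ; rewrite leq_exp2l.
Qed.

(** * Deterministic analysis of a run on accurate estimates *)

Section Runs.
Variables (R : realType) (n : nat).
Variable z : forall S : {group pauli n}, nat -> nat -> syndrome S.
Variables (X : {set pauli n}) (t : nat).
Variables (f : pauli n -> R) (A : {group pauli n} -> pauli n -> R) (eta : R) (J : nat).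
Hypotheses (eta_range : 0 < eta <= 200^-1) (f_range : forall x, 2^-1 <= f x <= 1).
Hypothesis f0 : f 0 = 1.
Hypothesis f_decay : forall x, x \in X -> x != 0 -> f x ^+ (2 ^ J) <= 4^-1.

Definition accurate (x : pauli n) (v : R) : Prop :=
  `|v - (1 - f x)| <= 224 * eta * (1 - f x).

Definition concentrated (S : {group pauli n}) (x : pauli n) : Prop :=
  2^-1 <= A S x <= 1 /\
  forall m, m \in lengths J ->
    `|estV R z t S m x - A S x * f x ^+ m| <= eta.

Definition resolved (r : estimate R n) (x : pauli n) : Prop :=
  exists2 v, r x = Some v & accurate x v.

(** Positive v and w exclude the fallback value 1. After a failed test, 3/10 feeds the invariant of
    the next doubling, and 1/4 contradicts the decay at the last one. *)
Lemma update_pending (S : {group pauli n}) (X' : {set pauli n}) j (r : estimate R n) x :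
  x \in X' -> concentrated S x -> (j <= J)%N ->
  r x = None -> 9 / 100 <= f x ^+ (2 ^ j) ->
  resolved (update z t S X' (2 ^ j) r) x \/
  update z t S X' (2 ^ j) r x = None /\ 3 / 10 <= f x ^+ (2 ^ j) /\ 4^-1 < f x ^+ (2 ^ j).
Proof.
move=> xX' [A_range conc] jJ rx g.
have /conc w_near : (2 ^ j)%N \in lengths J.
  by rewrite in_cons; apply/orP; right; apply/mapP; exists j; rewrite ?mem_iota.
have := conc 0%N (mem_head _ _); rewrite expr0 mulr1 => v_near.
have /andP[eta0 eta1] := eta_range; have /andP[A1 A2] := A_range.
have v0 := baseline_gt0 eta1 A1 v_near; have w0 := decayed_gt0 eta1 A1 w_near g.
rewrite /resolved /update ffunE xX' rx eqxx /= v0 w0 !andbT.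
case: (leP (estV R z t S (2 ^ j) x) (estV R z t S 0 x / 3)) => wv.
  left; eexists; first by [].
  by apply: (stopped_accuracy eta_range A_range (f_range x) _ v_near w_near g wv); rewrite expn_gt0.
right; have -> : (estV R z t S (2 ^ j) x <= 0) || (estV R z t S 0 x <= 0) = false.
  by rewrite !leNgt w0 v0.
split=> //; split; first exact: (not_stopped eta1 A1 v_near w_near wv).
rewrite ltNge; apply/negP => /(stopped eta1 A1 v_near w_near).
by rewrite leNgt wv.
Qed.

Lemma update_stable (S : {group pauli n}) (X' : {set pauli n}) m (r : estimate R n) x :
  (x \in X' -> r x <> None) -> update z t S X' m r x = r x.
Proof.
move=> h; rewrite /update ffunE; case: ifP => // /andP[/h rx /eqP]; contradiction.
Qed.

(** Induction on the number k of doublings left. A pending label carries f_x^(2^j) >= 9/100,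
    restored after a failed test by squaring 3/10; at k = 0, [f_decay] leaves no label pending. *)
Lemma while_run_exists (S : {group pauli n}) (X' : {set pauli n}) :
  X' \subset X -> 0 \notin X' -> (forall x, x \in X' -> concentrated S x) ->
  forall k j (r : estimate R n), (j + k = J)%N ->
  (forall x, x \in X' -> r x = None /\ 9 / 100 <= f x ^+ (2 ^ j) \/ resolved r x) ->
  exists r' ks, [/\ while_run z t S X' (2 ^ j)%N r r' ks,
    forall x, x \in X' -> resolved r' x,
    forall x, x \notin X' -> r' x = r x &
    {subset ks <= [seq (2 ^ i)%N | i <- iota 0 J.+1]}].
Proof.
move=> X'X X'0 conc k; elim: k => [|k IH] j r jk inv.
all: have [alldef|ndef] := boolP (all_defined X' r).
1,3: exists r, fset0; split=> //; first exact: While_stop.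
1,2: move=> x xX'; case: (inv x xX') => // -[rx _].
1,2: by have /forall_inP /(_ x xX') := alldef; rewrite rx.
all: have jJ : (j <= J)%N by rewrite -jk leq_addr.
all: have upd x : x \in X' -> resolved (update z t S X' (2 ^ j) r) x \/
  update z t S X' (2 ^ j) r x = None /\ 3 / 10 <= f x ^+ (2 ^ j) /\ 4^-1 < f x ^+ (2 ^ j).
1,3: move=> xX'; case: (inv x xX') => [[rx g]|rr]; first exact: update_pending (conc x xX') jJ rx g.
1,2: left; case: (rr) => v rv acc; exists v => //; rewrite update_stable // rv //.
all: have j_in : (2 ^ j)%N \in [seq (2 ^ i)%N | i <- iota 0 J.+1]
  by apply/mapP; exists j; rewrite ?mem_iota.
- have upd' x : x \in X' -> resolved (update z t S X' (2 ^ j) r) x.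
    move=> xX'; case: (upd x xX') => // -[_ [_]]; rewrite -[j]addn0 jk ltNge.
    by rewrite f_decay ?(fintype.subsetP X'X) //; apply: contraNneq X'0 => <-.
  exists (update z t S X' (2 ^ j) r), ((2 ^ j)%N |` (fset0 : {fset nat}))%fset; split=> //.
  + apply: While_step => //; apply: While_stop.
    by apply/forall_inP => x /upd' [v ->].
  + by move=> x xX'; rewrite update_stable // (negbTE xX').
  + by move=> m; rewrite !inE orbF => /eqP ->.
have [|x xX'|r' [ks [wr res stab sub]]] := IH j.+1 (update z t S X' (2 ^ j) r).
- by rewrite addSnnS.
- case: (upd x xX') => [|[-> [g _]]]; [by right|left]; split=> //.
  rewrite expnS mulnC exprM expr2.
  have : 3 / 10 * (3 / 10) <= f x ^+ (2 ^ j) * f x ^+ (2 ^ j) by apply: ler_pM; lra.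
  lra.
exists r', ((2 ^ j)%N |` ks)%fset; split=> //.
- by apply: While_step => //; rewrite -expnS.
- by move=> x xX'; rewrite stab // update_stable // (negbTE xX').
- by move=> m; rewrite !inE => /orP[/eqP -> //|/sub].
Qed.

(** V is the union of the groups already visited. A label is fresh only in the first group
    containing it, so concentration is asked for there alone. *)
Lemma for_run_exists (os : seq {group pauli n}) :
  forall (V : {set pauli n}) (r : estimate R n),
  (forall x, x \in X -> x != 0 -> x \notin V ->
     has (fun S : {group pauli n} => x \in S) os /\
     concentrated (nth 1%G os (find (fun S : {group pauli n} => x \in S) os)) x) ->
  (forall x, x \in X -> x != 0 -> x \notin V -> r x = None) ->
  (forall x, x \in X -> (x == 0) || (x \in V) -> resolved r x) ->
  exists r' ks, [/\ for_run z X t os V r r' ks,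
    forall x, x \in X -> resolved r' x &
    {subset ks <= lengths J}].
Proof.
elim: os => [|S os IH] V r conc pending res.
  exists r, fset0; split=> //; first exact: For_done.
  move=> x xX; apply: res => //; apply/orP; have [->|x0] := eqVneq x 0; first by left.
  (* An unvisited nonzero label would have to lie in a group of the empty list. *)
  by right; apply/negPn/negP => xV; have [] := conc x xX x0 xV.
have inF x : (x \in fresh X S V) = [&& x \in X, x \in S, x \notin V & x != 0].
  by rewrite !inE negb_or andbC -andbA [x \in S]inE //.
have concS x : x \in fresh X S V -> concentrated S x.
  by rewrite inF => /and4P[xX xS xV x0]; have [_] := conc x xX x0 xV; rewrite /= xS.
have conc' x : x \in X -> x != 0 -> x \notin (V :|: S)%SET ->
     has (fun S : {group pauli n} => x \in S) os /\
     concentrated (nth 1%G os (find (fun S : {group pauli n} => x \in S) os)) x.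
  move=> xX x0; rewrite inE negb_or => /andP[xV xS].
  by have := conc x xX x0 xV; rewrite /= (negbTE xS).
have [F0|/eqP Fn0] := eqVneq (fresh X S V) finset.set0.
  have [| |r' [ks [fr resr sub]]] := IH (V :|: S)%SET r conc'.
  - by move=> x xX x0; rewrite inE negb_or => /andP[xV _]; exact: pending.
  - move=> x xX; rewrite inE => h; apply: res => //.
    have [//|x0] := eqVneq x 0; have [//|xV] := boolP (x \in V).
    have := inF x; rewrite F0 inE xX xV x0 andbT /=.
    by move: h; rewrite (negbTE x0) (negbTE xV) /= => ->.
  by exists r', ks; split=> //; exact: For_skip.
have Fnone x : x \in fresh X S V -> r x = None.
  by rewrite inF => /and4P[xX xS xV x0]; exact: pending.
have FX : fresh X S V \subset X by apply/fintype.subsetP => x; rewrite inF => /andP[].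
have F_neq0 : 0 \notin fresh X S V by rewrite inF eqxx !andbF.
(* The loop is entered at length 1 = 2^0, where weakness gives f_x >= 1/2. *)
have Finit x : x \in fresh X S V -> r x = None /\ 9 / 100 <= f x ^+ (2 ^ 0) \/ resolved r x.
  move=> xF; left; split; first exact: Fnone.
  by rewrite expn0 expr1; have /andP[] := f_range x; lra.
have [r1 [ks1 [wr resw stab sub1]]] := while_run_exists FX F_neq0 concS (add0n J) Finit.
have [| |r' [ks [fr resr sub]]] := IH (V :|: S)%SET r1 conc'.
- move=> x xX x0; rewrite inE negb_or => /andP[xV xS].
  rewrite stab; first exact: pending.
  by rewrite inF (negbTE xS) andbF.
- move=> x xX; rewrite inE => h; have [/resw //|xF] := boolP (x \in fresh X S V).
  rewrite /resolved stab //; apply: res => //.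
  have [//|x0] := eqVneq x 0; have [//|xV] := boolP (x \in V).
  move: xF; rewrite inF xX xV x0 /= andbT.
  by move: h; rewrite (negbTE x0) (negbTE xV) /= => ->.
exists r', (0%N |` (ks1 `|` ks))%fset; split=> //.
  exact: (For_visit Fn0 (wr : while_run z t S _ 1%N r r1 ks1) fr).
move=> m; rewrite 3!in_fsetE => /or3P[/eqP -> |/sub1 mk|/sub //].
  exact: mem_head.
by rewrite in_cons mk orbT.
Qed.

Lemma ratio_run_exists (os : seq {group pauli n}) :
  (forall x, x \in X -> x != 0 ->
     has (fun S : {group pauli n} => x \in S) os /\
     concentrated (nth 1%G os (find (fun S : {group pauli n} => x \in S) os)) x) ->
  exists r ks, [/\ ratio_run z X t os r ks,
    forall x, x \in X -> resolved r x &
    {subset ks <= lengths J}].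
Proof.
move=> conc; apply: for_run_exists => [x xX x0 _|x xX x0 _|x xX].
- exact: conc.
- by rewrite ffunE (negbTE x0).
rewrite inE orbF => /eqP x0; exists 0; first by rewrite ffunE xX x0 eqxx.
by rewrite /accurate x0 f0 subrr mulr0 subr0 normr0.
Qed.

End Runs.

(** * Dependence of a run on finitely many outcomes *)

Section Locality.
Variables (R : realType) (n : nat) (X : {set pauli n}) (t M : nat).
Variables z z' : forall S : {group pauli n}, nat -> nat -> syndrome S.

Definition agree (S : {group pauli n}) : Prop :=
  forall m k, (m <= M)%N -> (k < t)%N -> z S m k = z' S m k.

Lemma estV_agree S m x : agree S -> (m <= M)%N -> estV R z t S m x = estV R z' t S m x.
Proof.
by move=> zz mM; rewrite /estV; congr (_ * _); apply: eq_bigr => k _; rewrite zz.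
Qed.

(** The loop reads the table only at length 0 and at the lengths recorded in [ks]. *)
Lemma while_run_agree S X' m (r r' : estimate R n) ks : agree S ->
  while_run z t S X' m r r' ks -> (forall m', m' \in ks -> (m' <= M)%N) ->
  while_run z' t S X' m r r' ks.
Proof.
move=> zz; elim=> {m r r' ks} [m r alldef _|m r r' ks ndef wr IH ksM].
  exact: While_stop.
have mM : (m <= M)%N by apply: ksM; rewrite !inE eqxx.
have upd : update z t S X' m r = update z' t S X' m r.
  by apply/ffunP => x; rewrite !ffunE !(estV_agree x zz).
apply: While_step => //; rewrite -upd; apply: IH => m' m'k.
by apply: ksM; rewrite !inE m'k orbT.
Qed.

Lemma for_run_agree os V (r r' : estimate R n) ks : (forall S, S \in os -> agree S) ->
  for_run z X t os V r r' ks -> (forall m', m' \in ks -> (m' <= M)%N) ->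
  for_run z' X t os V r r' ks.
Proof.
move=> zz fr; elim: fr zz => {os V r r' ks} [V r|S os V r r' ks F0 fr IH|
    S os V r r1 r' ks1 ks Fn0 wr fr IH] zz ksM.
- exact: For_done.
- by apply: For_skip => //; apply: IH => // S' S'os; apply: zz; rewrite inE S'os orbT.
apply: (@For_visit _ _ _ _ _ _ _ _ _ r1) => //.
  apply: while_run_agree wr _ => [|m mk]; first by apply: zz; rewrite mem_head.
  by apply: ksM; rewrite !inE mk orbT.
apply: IH => [S' S'os|m mk]; first by apply: zz; rewrite inE S'os orbT.
by apply: ksM; rewrite !inE mk !orbT.
Qed.

End Locality.

(** * Probability of a good run *)

(** Induction on I, splitting by the value of the first outcome; with no outcome left, B is empty or
    everything. *)
Lemma measurable_finitely_determined (R : realType) n (N : gtm_noise R n)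
    (d : measure_display) (T : measurableType d) (P : probability T R)
    (Z : forall S : {group pauli n}, nat -> nat -> T -> syndrome S)
    (I : seq ({group pauli n} * nat * nat)) (B : set T) :
  runcb_samples N P Z -> (forall i, i \in I -> stabilizer i.1.1) ->
  (forall w w', (forall i, i \in I -> Z i.1.1 i.1.2 i.2 w = Z i.1.1 i.1.2 i.2 w') ->
     B w -> B w') ->
  measurable B.
Proof.
move=> HZ; elim: I B => [|[[S m] k] I IH] B stab det.
  have [B0|] := pselect (B = set0)%classic; first by rewrite B0.
  move/eqP/set0P => [w Bw]; rewrite (_ : B = setT) //.
  by apply/seteqP; split=> // w' _; apply: det Bw.
(* The part of B with first outcome b need not be determined by the rest of I. Its saturation under
   agreement on I is, and meets the event of outcome b in the same set. *)
have -> : B = (\bigcup_(b in [set` enum {: syndrome S}])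
   ((Z S m k @^-1` [set b]) `&` [set w | exists2 w', B w' & Z S m k w' = b /\
      forall i, i \in I -> Z i.1.1 i.1.2 i.2 w' = Z i.1.1 i.1.2 i.2 w]))%classic.
  apply/seteqP; split=> [w Bw|w [b _ [/= wb [w' Bw' [w'b ww']]]]].
    exists (Z S m k w); first by rewrite /= mem_enum.
    by split=> //; exists w.
  apply: det Bw' => i; rewrite inE => /orP[/eqP -> /=|]; last exact: ww'.
  by rewrite wb.
apply: fin_bigcup_measurable => [|b _]; first exact: finite_seq.
apply: measurableI; first by apply: HZ.1; apply: (stab (S, m, k)); rewrite mem_head.
apply: IH => [i iI|w w' ww' [w0 Bw0 [w0b w0w]]].
  by apply: stab; rewrite inE iI orbT.
by exists w0 => //; split=> // i iI; rewrite w0w // ww'.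
Qed.

(** * Choice of the number of doublings and of the sample size *)

Lemma absz_ceil_ge (R : realType) (a : R) : 0 <= a -> a <= `|Num.ceil a|%N%:R.
Proof.
move=> a0; have c0 : 0 <= Num.ceil a by rewrite -(ler_int R) (le_trans a0) // ceil_ge.
by rewrite natr_absz ger0_norm // ceil_ge.
Qed.

Lemma ln2_ge_half (R : realType) : 2^-1 <= ln 2 :> R.
Proof.
have := @le_ln1Dx R (- 2^-1); rewrite (_ : 1 + - 2^-1 = 2^-1); last by lra.
by rewrite lnV ?posrE // => h; have {}h := h ltac:(lra); lra.
Qed.

Lemma expRN2_le (R : realType) : expR (- 2) <= 4^-1 :> R.
Proof.
rewrite expRN lef_pV2 ?posrE ?expR_gt0 //.
have := expR_ge1Dx (1 : R); rewrite (_ : (2 : R) = 1 + 1) ?expRD; last by lra.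
by move=> h; nra.
Qed.

Lemma eigval_le_gap (R : realType) n (N : gtm_noise R n) (X : {set pauli n}) (x : pauli n) :
  x \in X -> x != 0 -> eigval N x <= 1 - gap N X.
Proof.
move=> xX x0; rewrite /gap opprB addrC subrK; apply: le_trans (ler_norm _) _.
by apply: (le_bigmax_cond _ (fun x => `|eigval N x|)); rewrite !inE x0.
Qed.

(** Used with l = ln 2 and L = ln (1/gap): j <= 2 + 2 L, and the additive constants are absorbed
    because L >= l >= 1/2, that is, because the gap is at most 1/2. *)
Lemma loop_count_arith (R : realType) (j l L : R) : 2^-1 <= l -> l <= L -> 0 <= j ->
  j * l <= 2 * l + L -> j + 2 <= 10 * L.
Proof.
move=> l2 lL j0 jl; have [j2|j2] := lerP j 2; first lra.
have : (j - 2) * 2^-1 <= (j - 2) * l by rewrite ler_wpM2l //; lra.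
lra.
Qed.

(** J is the least exponent with 2^J >= 2/g; minimality bounds 2^J by 4/g, and taking logarithms
    bounds J + 2 by 10 ln(1/g). *)
Lemma doubling_length (R : realType) (g : R) : 0 < g <= 2^-1 ->
  exists J : nat, [/\ 2 / g <= (2 ^ J)%:R, (2 ^ J)%:R <= 1000 / g &
    (J.+2 <= `|Num.ceil (1000 * ln g^-1)|)%N].
Proof.
move=> /andP[g0 g2].
have ex : exists j, 2 / g <= (2 ^ j)%N%:R.
  exists `|Num.ceil (2 / g)|%N; apply: (le_trans (absz_ceil_ge _)).
    by rewrite divr_ge0 // ltW.
  by rewrite ler_nat ltnW // ltn_expl.
case: (ex_minnP ex) => J lo min.
have gi : 2 <= g^-1 by rewrite -[2]invrK lef_pV2 ?posrE // invr_gt0.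
have hi : (2 ^ J)%N%:R <= 4 / g.
  case: J lo min => [|J] lo min; first by move: lo; rewrite expn0; lra.
  rewrite expnS natrM; have : (2 ^ J)%N%:R < 2 / g.
    by rewrite ltNge; apply/negP => /min; rewrite ltnn.
  lra.
have l2 := ln2_ge_half R.
exists J; split=> //.
  by apply: le_trans hi _; rewrite ler_wpM2r ?ler_nat // invr_ge0 ltW.
have Lg : ln 2 <= ln g^-1 by rewrite ler_ln ?posrE ?invr_gt0.
have : J%:R * ln 2 <= 2 * ln 2 + ln g^-1.
  rewrite ![_%:R * ln 2]mulr_natl -!lnXn // -lnM ?posrE ?exprn_gt0 ?invr_gt0 //.
  rewrite ler_ln ?posrE ?mulr_gt0 ?exprn_gt0 ?invr_gt0 //.
  by rewrite -natrX (_ : 2 ^+ 2 = 4) //; lra.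
have J0 : 0 <= J%:R :> R by [].
move=> JL; have L0 : 0 <= ln g^-1.
  by apply: le_trans Lg; apply: le_trans l2; rewrite invr_ge0.
rewrite -(ler_nat R) -addn2 natrD; apply: le_trans (absz_ceil_ge (mulr_ge0 (ler0n _ _) L0)).
apply: le_trans (loop_count_arith l2 Lg J0 JL) _.
by apply: ler_wpM2r => //; rewrite ler_nat.
Qed.

(** The choice of t gives eps^2 t >= 2 ln Y >= ln Y, and 2 / Y is the share of delta allotted to one
    of the a b events; ln Y > 0 because Y >= 4. *)
Lemma sample_size (R : realType) (a b eps delta : R) : 1 <= a -> 1 <= b -> 0 < eps ->
  0 < delta <= 2^-1 ->
  let t := `|Num.ceil (2 / eps ^+ 2 * ln (2 * a * b / delta))|%N in
  (0 < t)%N /\ 2 * expR (- (eps ^+ 2 * t%:R)) <= delta / (a * b).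
Proof.
move=> a1 b1 eps0 /andP[delta0 delta1] t.
set Y := 2 * a * b / delta in t *.
have Y4 : 4 <= Y by rewrite ler_pdivlMr //; nra.
have lnY0 : 0 < ln Y by apply: ln_gt0; lra.
have e2 : 0 < eps ^+ 2 by rewrite exprn_gt0.
have tR : 2 / eps ^+ 2 * ln Y <= t%:R.
  by apply: absz_ceil_ge; rewrite mulr_ge0 ?divr_ge0 // ltW.
split; first by rewrite -(ltr0n R) (lt_le_trans _ tR) // mulr_gt0 ?divr_gt0.
have -> : delta / (a * b) = 2 * Y^-1.
  by rewrite /Y; field; rewrite !gt_eqF //; lra.
rewrite ler_wpM2l // -[Y]lnK ?posrE; last by lra.
rewrite -expRN ler_expR lerN2.
move: tR; rewrite mulrAC ler_pdivrMr // mulrC; lra.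
Qed.

Lemma gap_le_half (R : realType) n (N : gtm_noise R n) (X : {set pauli n}) (x : pauli n) :
  half_weak N -> x \in X -> x != 0 -> gap N X <= 2^-1.
Proof.
move=> /(_ x)/andP[fx _] xX x0; have := eigval_le_gap N xX x0; lra.
Qed.

Lemma accuracy_constants (R : realType) (eps : R) : 0 < eps <= 1000^-1 ->
  [/\ 0 < 3 * eps <= 200^-1, 0 <= eps <= 4^-1 & 224 * (3 * eps) <= 1000 * eps].
Proof. by move=> /andP[? ?]; split; [apply/andP; split| |]; lra. Qed.

Theorem proposition8 (R : realType) :
  exists eps0 delta0 C : R,
    [/\ 0 < eps0 < 1, 0 < delta0 < 1 & 0 < C] /\
    forall (n : nat) (X : {set pauli n}) (O : {set {group pauli n}})
           (os : seq {group pauli n}) (N : gtm_noise R n)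
           (d : measure_display) (T : measurableType d) (P : probability T R)
           (Z : forall S : {group pauli n}, nat -> nat -> T -> syndrome S)
           (eps delta : R),
      (1 <= n)%N ->
      (exists2 x, x \in X & x != 0) ->
      stabilizer_covering O X ->
      perm_eq os (enum O) ->
      half_weak N ->
      (forall S h, S \in O -> h \in S -> 2^-1 <= spam N S h) ->
      0 < gap N X ->
      runcb_samples N P Z ->
      0 < eps <= eps0 ->
      0 < delta <= delta0 ->
      let K := `|Num.ceil (C * ln (gap N X)^-1)|%N in
      let t := `|Num.ceil (2 / eps ^+ 2 * ln (2 * #|X|%:R * K%:R / delta))|%N in
      let good := [set omega : T |
        exists (rhat : estimate R n) (kappa : {fset nat}),
          [/\ ratio_run (fun S m k => Z S m k omega) X t os rhat kappa,
              (#|` kappa| <= K)%N,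
              forall m, m \in kappa -> m%:R <= C / gap N X
            & forall x, x \in X -> exists2 r, rhat x = Some r &
                `|r - infid N x| <= C * eps * infid N x]]%classic in
      measurable good /\ ((1 - delta)%:E <= P good)%E.
Proof.
(* [eps0] makes 3 eps <= 1/200. The constant 1000 covers 4 in the maximal length, 10 in the number
   of lengths and 224 * 3 = 672 in the accuracy. *)
exists (1000^-1), (2^-1), 1000; split; first by split; lra.
move=> n X O os N d T P Z eps delta n1 [x1 x1X x1n0] [stabO covO] osO weak stable gap0 HZ.
move=> eps_le delta_le.
have [eta_range eps_range eps_acc] := accuracy_constants eps_le.
set g := gap N X => K t good.
have g2 : 0 < g <= 2^-1 by rewrite gap0 (gap_le_half weak x1X x1n0).
have [J [Jlo Jhi JK]] := doubling_length g2; rewrite -/K in JK.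
have X1 : 1 <= #|X|%:R :> R by rewrite ler1n; apply/card_gt0P; exists x1.
have K1 : 1 <= K%:R :> R by rewrite ler1n (leq_trans _ JK).
have /andP[eps0 _] := eps_le.
have [t0 qle] := sample_size X1 K1 eps0 delta_le; rewrite -/t in t0 qle.
set q := 2 * _ in qle.
(* The group in which [Ratio] estimates x; the covering keeps the default [1%G] from being reached
   for x in X. *)
pose Sx x := nth 1%G os (find (fun S : {group pauli n} => x \in S) os).
have Shas x : x \in X -> has (fun S : {group pauli n} => x \in S) os.
  move=> xX; have [S SO xS] := covO x xX.
  by apply/hasP; exists S => //; rewrite (perm_mem osO) mem_enum.
have SxO x : x \in X -> Sx x \in O.
  by move=> xX; rewrite -mem_enum -(perm_mem osO) mem_nth // -has_find Shas.
have xSx x : x \in X -> x \in Sx x by move=> xX; exact: nth_find (Shas x xX).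
pose ms := lengths J.
have ms_le (m : nat) : m \in ms -> m%:R <= 1000 / g.
  by move=> /lengths_le mJ; apply: le_trans Jhi; rewrite ler_nat.
have f_decay x : x \in X -> x != 0 -> eigval N x ^+ (2 ^ J) <= 4^-1.
  move=> xX x0; apply: le_trans (expRN2_le R).
  have /andP[fx _] := weak x; have fx0 : 0 <= eigval N x by rewrite (le_trans _ fx).
  (* f_x <= 1 - g <= exp(-g), and 2^J >= 2/g makes the power at most exp(-2). *)
  apply: (@le_trans _ _ (expR (- g) ^+ (2 ^ J))).
    rewrite lerXn2r ?nnegrE ?expR_ge0 // (le_trans (eigval_le_gap N xX x0)) //.
    exact: expR_ge1Dx.
  rewrite -expRM_natl ler_expR mulrN lerN2.
  by move: Jlo; rewrite ler_pdivrMr.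
pose bad (i : pauli n * nat) : set T :=
  [set w | 3 * eps <= `|estV R (fun S m k => Z S m k w) t (Sx i.1) i.2 i.1 -
           spam N (Sx i.1) i.1 * eigval N i.1 ^+ i.2|]%classic.
(* |X| (J + 2) <= |X| K events, each of probability at most delta / (|X| K). *)
pose idx := [seq (x, m) | x <- enum X, m <- ms].
have badP i : i \in idx -> measurable (bad i) /\ (P (bad i) <= q%:E)%E.
  case/allpairsP => -[x m] [/= xX mm ->]; rewrite mem_enum in xX.
  exact: (estimate_deviation HZ m (stabO _ (SxO x xX)) (xSx x xX) eps_range t0).
have goodP w : (forall i, i \in idx -> ~ bad i w) -> good w.
  move=> nbad.
  have conc x : x \in X -> x != 0 ->
     has (fun S : {group pauli n} => x \in S) os /\
     concentrated (fun S m k => Z S m k w) t (eigval N) (spam N) (3 * eps) J (Sx x) x.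
    move=> xX x0; split; first exact: Shas.
    split.
      rewrite stable ?SxO ?xSx //=.
      by have := spam_le1 HZ 0 (stabO _ (SxO x xX)) (xSx x xX); rewrite expr0 mulr1.
    move=> m mm; apply/ltW; rewrite ltNge; apply/negP.
    by apply: (nbad (x, m)); apply/allpairsP; exists (x, m); rewrite mem_enum.
  have [r [ks [rr res sub]]] :=
    ratio_run_exists eta_range weak (eigval0 N) f_decay conc.
  exists r, ks; split=> //.
  - apply: leq_trans JK; have -> : J.+2 = size ms by rewrite /= size_map size_iota.
    exact: uniq_leq_size (fset_uniq ks) sub.
  - by move=> m /sub; exact: ms_le.
  move=> x xX; have [v rv acc] := res x xX; exists v => //.
  apply: (le_trans acc); rewrite -/(infid N x).
  have /andP[_ fx] := weak x; have i0 : 0 <= infid N x by rewrite /infid subr_ge0.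
  exact: ler_wpM2r.
have mgood : measurable good.
  (* The event [good] itself bounds the lengths by 1000/g, so a witnessing run reads only the
     entries listed in I and remains a run for any table agreeing there. *)
  pose M := `|Num.ceil (1000 / g)|%N.
  pose I := [seq (Sm, k) | Sm <- [seq (G, m) | G <- os, m <- iota 0 M.+1], k <- iota 0 t].
  apply: (measurable_finitely_determined (I := I) HZ) => [i|w w' ww'].
    case/allpairsP => -[Sm k] [Smin _ ->].
    have /allpairsP[[G m] [Gos _ /= ->]] := Smin.
    by apply: stabO; rewrite -mem_enum -(perm_mem osO); exact: Gos.
  case=> r [ks [rr ksK ksM res]]; exists r, ks; split=> //.
  apply: (for_run_agree (M := M) _ rr) => [S Sos m k mM kt|m /ksM mle].
    apply: (ww' (S, m, k)).
    have Sm : (S, m) \in [seq (G, m) | G <- os, m <- iota 0 M.+1].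
      by apply: allpairs_f => //; rewrite mem_iota.
    by apply: (allpairs_f (fun Sm k => (Sm, k)) Sm); rewrite mem_iota.
  rewrite -(ler_nat R); apply: le_trans mle _; apply: absz_ceil_ge.
  exact: divr_ge0 (ler0n _ _) (ltW gap0).
split=> //.
have idx_uniq : uniq idx.
  by apply: allpairs_uniq => //; [exact: enum_uniq | exact: lengths_uniq | move=> [? ?] [? ?] _ _].
have : (P (~` good)%classic <= (\sum_(i <- idx) q)%:E)%E.
  apply: (prob_bigcup_le idx_uniq (measurableC mgood) (fun i h => (badP i h).1)
    (fun i h => (badP i h).2)) => w ngood.
  apply: contrapT => nex; apply: ngood; apply: goodP => i iI bi; apply: nex.
  by exists i.
have sumq : \sum_(i <- idx) q <= delta.
  rewrite big_const_seq count_predT size_allpairs -cardE iter_addr_0 /= size_map size_iota.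
  apply: (@le_trans _ _ (q *+ (#|X| * K))).
    by rewrite ler_wpMn2l ?leq_mul2l ?JK ?orbT // mulr_ge0 ?expR_ge0.
  by rewrite -mulr_natr natrM -ler_pdivlMr // mulr_gt0 // (lt_le_trans ltr01).
rewrite probability_setC // => h.
have {h} : (1 - P good <= delta%:E)%E by apply: le_trans h _; rewrite lee_fin.
have : P good \is a fin_num by exact: fin_num_measure.
by case: (P good) => // p _; rewrite -EFinB !lee_fin !lerBlDr addrC.
Qed.
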